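(* Let $K$ be a $\Delta$-$\sigma$-field of characteristic zero with basic sets $\Delta=\{\delta_1,\dots,\delta_m\}$ (derivations) and $\sigma=\{\alpha_1,\dots,\alpha_n\}$ (automorphisms), and let a partition $\Delta=\Delta_1\cup\dots\cup\Delta_p$ ($p\ge 1$) into disjoint subsets be fixed, where $\Delta_1=\{\delta_1,\dots,\delta_{m_1}\}$, $\Delta_2=\{\delta_{m_1+1},\dots,\delta_{m_1+m_2}\}$, $\dots$, $\Delta_p=\{\delta_{m_1+\dots+m_{p-1}+1},\dots,\delta_m\}$ and $m_1+\dots+m_p=m$. Let $L=K\langle\eta_1,\dots,\eta_s\rangle$ be a $\Delta$-$\sigma$-field extension of $K$ generated by a finite set $\eta=\{\eta_1,\dots,\eta_s\}$. Then there exists a polynomial $\Phi_\eta(t_1,\dots,t_{p+1})$ in $p+1$ variables with rational coefficients such that: (i) $\Phi_\eta(r_1,\dots,r_{p+1})=\operatorname{trdeg}_K K\bigl(\bigcup_{j=1}^{s}\Lambda(r_1,\dots,r_{p+1})\eta_j\bigr)$ for all sufficiently large $(r_1,\dots,r_{p+1})\in\mathbf N^{p+1}$ (that is, there exist nonnegative integers $s_1,\dots,s_{p+1}$ such that the equality holds for all $(r_1,\dots,r_{p+1})\in\mathbf N^{p+1}$ with $r_1\ge s_1,\dots,r_{p+1}\ge s_{p+1}$). (ii) $\deg_{t_i}\Phi_\eta\le m_i$ for $1\le i\le p$ and $\deg_{t_{p+1}}\Phi_\eta\le n$, so that $\deg\Phi_\eta\le m+n$, and $\Phi_\eta$ can be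 represented as $$\Phi_\eta(t_1,\dots,t_{p+1})=\sum_{i_1=0}^{m_1}\dots\sum_{i_p=0}^{m_p}\sum_{i_{p+1}=0}^{n}a_{i_1\dots i_{p+1}}\binom{t_1+i_1}{i_1}\dots\binom{t_{p+1}+i_{p+1}}{i_{p+1}}$$ where all $a_{i_1\dots i_{p+1}}\in\mathbf Z$ and $2^n\mid a_{m_1\dots m_p n}$. (iii) Let $E_\eta=\{(i_1,\dots,i_{p+1})\in\mathbf N^{p+1} : 0\le i_k\le m_k \text{ for } k=1,\dots,p,\ 0\le i_{p+1}\le n,\ a_{i_1\dots i_{p+1}}\ne 0\}$. Then the total degree $d=\deg\Phi_\eta$, the coefficient $a_{m_1\dots m_p n}$, the elements $(k_1,\dots,k_{p+1})\in E_\eta'$, the corresponding coefficients $a_{k_1\dots k_{p+1}}$, and the coefficients of the terms of total degree $d$ do not depend on the choice of the finite system of $\Delta$-$\sigma$-generators $\eta$ of $L/K$.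
   Context: $\mathbf N$ denotes the nonnegative integers. A $\Delta$-$\sigma$-ring (difference-differential ring) is a commutative ring $R$ with finite sets $\Delta=\{\delta_1,\dots,\delta_m\}$ of derivations and $\sigma=\{\alpha_1,\dots,\alpha_n\}$ of automorphisms of $R$ such that any two mappings in $\Delta\cup\sigma$ commute; a $\Delta$-$\sigma$-field is a $\Delta$-$\sigma$-ring that is a field. A $\Delta$-$\sigma$-field extension $L/K$ is a field extension in which $L$ is a $\Delta$-$\sigma$-field and $K$ is a subfield closed under $\Delta$ and under all $\alpha_j^{\pm1}$, with the restricted operators. $\Lambda$ is the free commutative semigroup of formal power products $\lambda=\delta_1^{k_1}\cdots\delta_m^{k_m}\alpha_1^{l_1}\cdots\alpha_n^{l_n}$ with $k_i\in\mathbf N$, $l_j\in\mathbf Z$; it acts on any $\Delta$-$\sigma$-ring. For $\Lambda'\subseteq\Lambda$ and $x\in L$, $\Lambda' x=\{\lambda x:\lambda\in\Lambda'\}$. $L=K\langle\eta_1,\dots,\eta_s\rangle$ means that $L$ is the smallest $\Delta$-$\sigma$-subfield of $L$ containing $K$ and all $\eta_i$, i.e. $L=K(\{\lambda\eta_j:\lambda\in\Lambda,\ 1\le j\le s\})$ as a field; then $\eta$ is called a system of $\Delta$-$\sigma$-generators of $L/K$. For $\lambda=\delta_1^{k_1}\cdots\delta_m^{k_m}\alpha_1^{l_1}\cdots\alpha_n^{l_n}\in\Lambda$, $\operatorname{ord}_i\lambda$ ($1\le i\le p$) is the sum of the exponents $k_\nu$ over those $\nu$ with $\delta_\nu\in\Delta_i$,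 and $\operatorname{ord}_\sigma\lambda=\sum_{j=1}^n|l_j|$. For $r_1,\dots,r_{p+1}\in\mathbf N$, $\Lambda(r_1,\dots,r_{p+1})=\{\lambda\in\Lambda:\operatorname{ord}_i\lambda\le r_i\ (1\le i\le p),\ \operatorname{ord}_\sigma\lambda\le r_{p+1}\}$. For a permutation $(j_1,\dots,j_{p+1})$ of $\{1,\dots,p+1\}$, $<_{j_1,\dots,j_{p+1}}$ is the lexicographic order on $\mathbf N^{p+1}$ in which $(r_1,\dots,r_{p+1})<_{j_1,\dots,j_{p+1}}(s_1,\dots,s_{p+1})$ iff $r_{j_1}<s_{j_1}$ or there is $1\le k\le p$ with $r_{j_\nu}=s_{j_\nu}$ for $\nu=1,\dots,k$ and $r_{j_{k+1}}<s_{j_{k+1}}$. For $\Sigma\subseteq\mathbf N^{p+1}$, $\Sigma'$ denotes the set of all $e\in\Sigma$ that are maximal elements of $\Sigma$ with respect to at least one of these $(p+1)!$ lexicographic orders. $\binom{t}{k}$ for $k\ge1$ is the polynomial $t(t-1)\cdots(t-k+1)/k!$, and $\binom t0=1$. *)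

(* Defs.v *)
From HB Require Import structures.
From mathcomp Require Import all_boot all_order all_algebra fingroup perm.
From mathcomp Require Import classical_sets.
From mathcomp.multinomials Require Import mpoly.

Set Implicit Arguments.
Unset Strict Implicit.
Unset Printing Implicit Defensive.

Import Order.TTheory GRing.Theory Num.Theory.

Local Open Scope classical_set_scope.
Local Open Scope ring_scope.

(* The operators are indexed families, not sets, so that formal power products
   can be read off exponent vectors.  [auti] is the (unique) inverse of [aut]. *)
Record dsStructure (m n : nat) (R : comNzRingType) := DSStructure {
  der : 'I_m -> {additive R -> R};
  aut : 'I_n -> {rmorphism R -> R};
  auti : 'I_n -> R -> R;
  derM : forall i x y, der i (x * y) = der i x * y + x * der i y;
  autK : forall j, cancel (aut j) (auti j);
  autiK : forall j, cancel (auti j) (aut j);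
  der_derC : forall i j x, der i (der j x) = der j (der i x);
  der_autC : forall i j x, der i (aut j x) = aut j (der i x);
  aut_autC : forall i j x, aut i (aut j x) = aut j (aut i x)
}.

Section PowerProducts.
Variables m n p : nat.

(* Exponent vectors (k_1, ..., k_m) and (l_1, ..., l_n). *)
Definition power_product : Type := {ffun 'I_m -> nat} * {ffun 'I_n -> int}.

Definition aut_pow (R : comNzRingType) (D : dsStructure m n R) (j : 'I_n)
    (l : int) : R -> R :=
  match l with
  | Posz k => iter k (aut D j)
  | Negz k => iter k.+1 (auti D j)
  end.

Definition pp_act (R : comNzRingType) (D : dsStructure m n R)
    (lam : power_product) (x : R) : R :=
  (\big[(fun f g : R -> R => f \o g)/id]_(i < m) iter (lam.1 i) (der D i))
    ((\big[(fun f g : R -> R => f \o g)/id]_(j < n) aut_pow D j (lam.2 j)) x).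

(* [mm k] is the size of the k-th block of consecutive derivations. *)
Variable mm : 'I_p -> nat.

Definition in_block (k : 'I_p) (nu : 'I_m) : bool :=
  (\sum_(i < p | i < k) mm i <= nu < \sum_(i < p | i <= k) mm i)%N.

(* Indices in 'I_p.+1 run over the p blocks of derivations, followed by
   sigma at [ord_max]; [unlift ord_max] tells the two cases apart. *)
Definition pp_ord (lam : power_product) (k : 'I_p.+1) : nat :=
  if unlift ord_max k is Some i then (\sum_(nu < m | in_block i nu) lam.1 nu)%N
  else (\sum_(j < n) absz (lam.2 j))%N.

Definition pp_box (r : 'I_p.+1 -> nat) : set power_product :=
  [set lam | forall k, (pp_ord lam k <= r k)%N].

(* (m_1, ..., m_p, n) *)
Definition block_sizes : {ffun 'I_p.+1 -> nat} :=
  [ffun k => if unlift ord_max k is Some i then mm i else n].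

End PowerProducts.

Section Fields.
Variable L : fieldType.

Definition subfield (F : set L) : Prop :=
  [/\ F 1, (forall x y, F x -> F y -> F (x - y)) &
      (forall x y, F x -> F y -> F (x / y))].

Definition field_gen (K S : set L) : set L := smallest subfield (K `|` S).

Definition algebraic_over (M : set L) (y : L) : Prop :=
  exists q : {poly L}, [/\ q != 0, (forall i : nat, M q`_i) & root q y].

Definition alg_indep (K : set L) (d : nat) (x : 'I_d -> L) : Prop :=
  forall q : {mpoly L[d]}, (forall mon, K q@_mon) -> q.@[x] = 0 -> q = 0.

Definition transcendence_basis (K F : set L) (d : nat) (x : 'I_d -> L) : Prop :=
  [/\ (forall i, F (x i)), alg_indep K x &
      (forall y, F y -> algebraic_over (field_gen K (range x)) y)].

(* [F] has finite transcendence degree [d] over its subfield [K]. *)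
Definition has_trdeg (K F : set L) (d : nat) : Prop :=
  exists x : 'I_d -> L, transcendence_basis K F x.

Variables (m n : nat) (D : dsStructure m n L).

Definition ds_subfield (F : set L) : Prop :=
  [/\ subfield F, (forall i x, F x -> F (der D i x)),
      (forall j x, F x -> F (aut D j x)) &
      (forall j x, F x -> F (auti D j x))].

(* L = K<eta_1, ..., eta_s> *)
Definition ds_generates (K : set L) (s : nat) (eta : 'I_s -> L) : Prop :=
  smallest ds_subfield (K `|` range eta) = [set: L].

Variables (p : nat) (mm : 'I_p -> nat).

Definition box_orbit (s : nat) (eta : 'I_s -> L) (r : 'I_p.+1 -> nat) : set L :=
  [set y | exists (j : 'I_s) (lam : power_product m n),
     pp_box mm r lam /\ y = pp_act D lam (eta j)].

Definition is_dim_poly (K : set L) (s : nat) (eta : 'I_s -> L)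
    (Phi : {mpoly rat[p.+1]}) : Prop :=
  exists r0 : 'I_p.+1 -> nat, forall r : 'I_p.+1 -> nat,
    (forall k, (r0 k <= r k)%N) ->
    exists2 d : nat, has_trdeg K (field_gen K (box_orbit eta r)) d &
                     Phi.@[fun k => (r k)%:R] = d%:R.

End Fields.

Section NumericalPolynomials.
Variable N : nat.

(* q (q - 1) ... (q - k + 1) / k! *)
Definition mpoly_binom (q : {mpoly rat[N]}) (k : nat) : {mpoly rat[N]} :=
  (k`!%:R)^-1 *: \prod_(j < k) (q - j%:R).

(* Only the values of [a] on the box [0 <= i <= u] matter. *)
Definition binom_expansion (u : {ffun 'I_N -> nat})
    (a : {ffun 'I_N -> nat} -> int) : {mpoly rat[N]} :=
  \sum_(i : {dffun forall k : 'I_N, 'I_(u k).+1})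
    (a [ffun k => i k : nat])%:~R *:
      \prod_(k < N) mpoly_binom ('X_k + (i k : nat)%:R) (i k).

Definition degree_in (k : 'I_N) (q : {mpoly rat[N]}) : nat :=
  \max_(mon <- msupp q) mon k.

Definition expansion_support (u : {ffun 'I_N -> nat})
    (a : {ffun 'I_N -> nat} -> int) : set {ffun 'I_N -> nat} :=
  [set e : {ffun 'I_N -> nat} | (forall k, (e k <= u k)%N) /\ a e <> 0].

Definition lex_lt (j : {perm 'I_N}) (r s : {ffun 'I_N -> nat}) : Prop :=
  exists k : 'I_N, (forall nu : 'I_N, (nu < k)%N -> r (j nu) = s (j nu)) /\
                   (r (j k) < s (j k))%N.

Definition lex_maximal (Sigma : set {ffun 'I_N -> nat}) :
    set {ffun 'I_N -> nat} :=
  [set e : {ffun 'I_N -> nat} | Sigma e /\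
     exists j : {perm 'I_N}, forall f, Sigma f -> ~ lex_lt j e f].

End NumericalPolynomials.

(* Main.v *)
Require Import Defs.
From HB Require Import structures.
From mathcomp Require Import all_boot all_order all_algebra fingroup perm.
From mathcomp Require Import boolp classical_sets ring zify.
From mathcomp.multinomials Require Import mpoly.

Set Implicit Arguments.
Unset Strict Implicit.
Unset Printing Implicit Defensive.

Import Order.TTheory GRing.Theory Num.Theory.

Local Open Scope classical_set_scope.
Local Open Scope ring_scope.

(** Algebraic closure over [K] satisfies the exchange property, so transcendence
    degrees are ranks in a pregeometry.  Every operator (a derivation, an
    automorphism or its inverse) sends a relation [y \in acl S] to
    [op y \in acl (S, op S)].  Order the pairs (power product, generator) by a
    monomial order on words in the operators and call a pair dependent in the box
    [r] when it is algebraic over the smaller pairs of that box: the rank of the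
    box is the number of its independent pairs.  Encoding the box by slack
    variables, dependence in an orthant of exponents becomes an up-closed set of
    monomials.  By Dickson's lemma it is a finite union of cones, and
    inclusion-exclusion writes the number of monomials of multidegree [r] outside
    it as an integer combination of products of binomials, whose top coefficient
    is 1 if no pair is dependent and 0 otherwise.

    Hence the top coefficient of the dimension polynomial counts the pairs
    (orthant, generator) without dependent power products.  If [d] generators are
    free in one orthant, a translation by automorphisms makes all their power
    products independent, which bounds the top coefficient below by [2 ^ n * d];
    taking [d] maximal gives equality.

    Two systems of generators have dimension polynomials with
    [Phi r <= Psi (r + c)] and [Psi r <= Phi (r + c)] for large [r].  Evaluated
    along the curves [r_k = v_k * x ^ w_k], these inequalities force the leading
    forms for the weights [w] to coincide.  Equal weights give the terms of
    maximal total degree; rapidly decreasing weights give the maximal elements for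
    the lexicographic orders. *)

(** * Algebraic closure inside a field *)

Section SubfieldType.
Variables (L : fieldType) (F : set L) (sF : subfield F).

Definition subfield_mem of subfield F : {pred L} := fun x => `[< F x >].

Lemma subfield_memP x : reflect (F x) (x \in subfield_mem sF).
Proof. exact: asboolP. Qed.

Lemma subfield_mem_divring : divring_closed (subfield_mem sF).
Proof.
case: (sF) => F1 FB FV; split; first exact/subfield_memP.
- by move=> x y /subfield_memP Fx /subfield_memP Fy; apply/subfield_memP/FB.
- by move=> x y /subfield_memP Fx /subfield_memP Fy; apply/subfield_memP/FV.
Qed.

HB.instance Definition _ :=
  GRing.isDivringClosed.Build L (subfield_mem sF) subfield_mem_divring.

(** Turning the set [F] into a field type makes the theory of [algebraicOver] for field embeddings
    applicable to it. *)
Record subfield_sort := SubfieldSort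
  { subfield_val : L; subfield_valP : subfield_val \in subfield_mem sF }.

HB.instance Definition _ := [isSub for subfield_val].
HB.instance Definition _ := [Choice of subfield_sort by <:].
HB.instance Definition _ := [SubChoice_isSubComUnitRing of subfield_sort by <:].
HB.instance Definition _ :=
  [SubComUnitRing_isSubIntegralDomain of subfield_sort by <:].
HB.instance Definition _ :=
  [SubIntegralDomain_isSubField of subfield_sort by <:].

Lemma algebraic_over_subfield y :
  algebraic_over F y <-> algebraicOver (val : subfield_sort -> L) y.
Proof.
split=> [[q [q0 Fq qy]]|[q q0 qy]].
- have [q' qE] : exists q' : {poly subfield_sort}, map_poly val q' = q.
    exists (\poly_(i < size q) SubfieldSort (introT (subfield_memP _) (Fq i))).
    apply/polyP => i; rewrite coef_map coef_poly.
    by case: ltnP => // qi; rewrite nth_default //; apply: rmorph0.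
  exists q'; last by rewrite qE.
  by apply: contraNneq q0 => q'0; rewrite -qE q'0 map_poly0.
- exists (map_poly val q); split=> // [|i]; first by rewrite map_poly_eq0.
  by rewrite coef_map; apply/subfield_memP; apply: valP.
Qed.

End SubfieldType.

Section FieldGen.
Variable L : fieldType.
Implicit Types (F M K S T : set L) (x y z : L).

Lemma subfield1 F : subfield F -> F 1. Proof. by case. Qed.
Lemma subfieldB F x y : subfield F -> F x -> F y -> F (x - y).
Proof. by case=> _ + _; apply. Qed.
Lemma subfield_div F x y : subfield F -> F x -> F y -> F (x / y).
Proof. by case=> _ _; apply. Qed.
Lemma subfield0 F : subfield F -> F 0.
Proof. by move=> sF; rewrite -(subrr 1); apply: subfieldB => //; apply: subfield1. Qed.
Lemma subfieldN F x : subfield F -> F x -> F (- x).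
Proof. by move=> sF Fx; rewrite -sub0r; apply: subfieldB => //; apply: subfield0. Qed.
Lemma subfieldD F x y : subfield F -> F x -> F y -> F (x + y).
Proof. by move=> sF Fx Fy; rewrite -[y]opprK; apply: subfieldB => //; apply: subfieldN. Qed.
Lemma subfieldV F x : subfield F -> F x -> F x^-1.
Proof. by move=> sF Fx; rewrite -div1r; apply: subfield_div => //; apply: subfield1. Qed.
Lemma subfieldM F x y : subfield F -> F x -> F y -> F (x * y).
Proof. by move=> sF Fx Fy; rewrite -[y]invrK; apply: subfield_div => //; apply: subfieldV. Qed.
Lemma subfieldX F x n : subfield F -> F x -> F (x ^+ n).
Proof.
move=> sF Fx; elim: n => [|n IH]; first by rewrite expr0; apply: subfield1.
by rewrite exprS; apply: subfieldM.
Qed.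
Lemma subfield_nat F n : subfield F -> F n%:R.
Proof.
move=> sF; elim: n => [|n IH]; first exact: subfield0.
by rewrite mulrSr; apply: subfieldD => //; apply: subfield1.
Qed.
Lemma subfield_sum F I (r : seq I) (P : pred I) (f : I -> L) :
  subfield F -> (forall i, P i -> F (f i)) -> F (\sum_(i <- r | P i) f i).
Proof.
move=> sF Ff; elim/big_rec: _ => [|i x Pi Fx]; first exact: subfield0.
by apply: subfieldD => //; apply: Ff.
Qed.
Lemma subfield_prod F I (r : seq I) (P : pred I) (f : I -> L) :
  subfield F -> (forall i, P i -> F (f i)) -> F (\prod_(i <- r | P i) f i).
Proof.
move=> sF Ff; elim/big_rec: _ => [|i x Pi Fx]; first exact: subfield1.
by apply: subfieldM => //; apply: Ff.
Qed.
Lemma subfield_horner F (q : {poly L}) x :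
  subfield F -> (forall i : nat, F q`_i) -> F x -> F q.[x].
Proof.
move=> sF Fq Fx; rewrite horner_coef; apply: subfield_sum => // i _.
by apply: subfieldM => //; apply: subfieldX.
Qed.

Lemma field_gen_subfield K S : subfield (field_gen K S).
Proof.
split=> [F [sF _]|x y Fx Fy F FS|x y Fx Fy F FS]; first exact: subfield1.
- by case: (FS) => sF _; apply: subfieldB => //; [apply: Fx|apply: Fy].
- by case: (FS) => sF _; apply: subfield_div => //; [apply: Fx|apply: Fy].
Qed.

Lemma sub_field_genl K S : K `<=` field_gen K S.
Proof. by move=> x Kx; apply: sub_gen_smallest; left. Qed.

Lemma sub_field_genr K S : S `<=` field_gen K S.
Proof. by move=> x Sx; apply: sub_gen_smallest; right. Qed.

Lemma field_gen_sub K S F :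
  subfield F -> K `<=` F -> S `<=` F -> field_gen K S `<=` F.
Proof. by move=> sF KF SF; apply: smallest_sub => // x []; [apply: KF|apply: SF]. Qed.

Lemma field_genS K S T : S `<=` T -> field_gen K S `<=` field_gen K T.
Proof.
move=> ST; apply: field_gen_sub; first exact: field_gen_subfield.
  exact: sub_field_genl.
by move=> x /ST; apply: sub_field_genr.
Qed.

Lemma algebraic_overS F M y : F `<=` M -> algebraic_over F y -> algebraic_over M y.
Proof. by move=> FM [q [q0 Fq qy]]; exists q; split=> // i; apply: FM. Qed.

Lemma algebraic_over_mem F y : subfield F -> F y -> algebraic_over F y.
Proof.
move=> sF Fy; exists ('X - y%:P); split; first by rewrite polyXsubC_eq0.
- move=> i; rewrite coefB coefX coefC; apply: subfieldB => //.
    exact: subfield_nat.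
  by case: eqP => // _; apply: subfield0.
- by rewrite root_XsubC.
Qed.

Lemma subfield_algebraic_over F : subfield F -> subfield (algebraic_over F).
Proof.
move=> sF; split; first exact: (algebraic_over_mem sF (subfield1 sF)).
- move=> x y /(algebraic_over_subfield sF) ax /(algebraic_over_subfield sF) ay.
  exact/(algebraic_over_subfield sF)/algebraic_sub.
- move=> x y /(algebraic_over_subfield sF) ax /(algebraic_over_subfield sF) ay.
  exact/(algebraic_over_subfield sF)/algebraic_div.
Qed.

(** Over a field, algebraic and integral elements coincide, and integrality is transitive. *)
Lemma algebraic_over_trans F y :
  subfield F -> algebraic_over (algebraic_over F) y -> algebraic_over F y.
Proof.
move=> sF [q [q0 Fq qy]]; apply/(algebraic_over_subfield sF).
apply/integral_algebraic/(integral_root q0 qy)/integral_poly => i.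
exact/integral_algebraic/(algebraic_over_subfield sF).
Qed.

End FieldGen.

Section Fractions.
Variables (L : fieldType) (A : set L).
Hypotheses (A1 : A 1) (AB : forall x y, A x -> A y -> A (x - y))
  (AM : forall x y, A x -> A y -> A (x * y)).

(** The fraction field of the subring [A] inside [L]. With [A] the set of values of polynomials over
    a subfield, it serves to clear denominators in a relation over a generated field. *)
Definition fractions : set L := [set z | exists2 b, A b /\ b != 0 & A (b * z)].

Lemma fractions_sub : A `<=` fractions.
Proof. by move=> x Ax; exists 1; rewrite ?oner_eq0 ?mul1r. Qed.

Lemma subfield_fractions : subfield fractions.
Proof.
split; first exact: fractions_sub.
- move=> x y [b [Ab b0] Ax] [c [Ac c0] Ay].
  exists (b * c); first by (split; [apply: AM | apply: mulf_neq0]).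
  have -> : b * c * (x - y) = c * (b * x) - b * (c * y) by ring.
  by apply: AB; apply: AM.
- move=> x y [b [Ab b0] Ax] [c [Ac c0] Ay].
  have [->|y0] := eqVneq y 0.
    by exists 1; rewrite ?oner_eq0 // invr0 !mulr0 -(subrr 1); exact: AB.
  exists (b * (c * y)); first by (split; [apply: AM | rewrite !mulf_neq0]).
  have -> : b * (c * y) * (x / y) = c * (b * x).
    by rewrite [b * _]mulrCA -!mulrA [y * _]mulrCA divff ?mulr1.
  exact: AM.
Qed.

Lemma fractions_common_denominator (z : nat -> L) n :
  (forall i, fractions (z i)) ->
  exists2 b, A b /\ b != 0 & forall i, (i < n)%N -> A (b * z i).
Proof.
move=> Fz; elim: n => [|n [b [Ab b0] bz]]; first by exists 1; rewrite ?oner_eq0.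
have [c [Ac c0] cz] := Fz n.
exists (b * c); first by (split; [apply: AM | apply: mulf_neq0]).
move=> i; rewrite ltnS leq_eqVlt => /predU1P[->|/bz bzi].
  by rewrite -mulrA; apply: AM.
by rewrite mulrAC mulrC; apply: AM.
Qed.

End Fractions.

Section AlgebraicClosure.
Variables (L : fieldType) (K : set L).
Implicit Types (S T : set L) (x y : L).

Definition acl S : set L := algebraic_over (field_gen K S).

Lemma acl_subfield S : subfield (acl S).
Proof. exact/subfield_algebraic_over/field_gen_subfield. Qed.

Lemma field_gen_acl S : field_gen K S `<=` acl S.
Proof. by move=> x; apply/algebraic_over_mem/field_gen_subfield. Qed.

Lemma sub_acl S : S `<=` acl S.
Proof. by move=> x Sx; apply: field_gen_acl; apply: sub_field_genr. Qed.

Lemma sub_acl_field_gen S T : S `<=` acl T -> field_gen K S `<=` acl T.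
Proof.
move=> ST; apply: field_gen_sub => //; first exact: acl_subfield.
by move=> x Kx; apply: field_gen_acl; apply: sub_field_genl.
Qed.

Lemma acl_sub S T : S `<=` acl T -> acl S `<=` acl T.
Proof.
move=> ST x Sx; apply: algebraic_over_trans; first exact: field_gen_subfield.
by apply: (algebraic_overS _ Sx); apply: sub_acl_field_gen.
Qed.

Lemma aclS S T : S `<=` T -> acl S `<=` acl T.
Proof. by move=> ST; apply: acl_sub => x /ST; apply: sub_acl. Qed.

Lemma acl_exchange S x y :
  acl (x |` S) y -> ~ acl S y -> acl (y |` S) x.
Proof.
(* Clear denominators in the relation satisfied by [y] over [K(S, x)] and reorder
   it by powers of [x]: one of its coefficients, a polynomial in [y], is nonzero. *)
move=> [q [q0 Fq qy]] nSy; set F := field_gen K S.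
have sF : subfield F by apply: field_gen_subfield.
pose A := [set z | exists2 P : {poly L}, (forall i : nat, F P`_i) & z = P.[x]].
have A1 : A 1.
  exists 1 => [i|]; last by rewrite hornerE.
  by rewrite coef1; apply: (subfield_nat _ sF).
have AB z t : A z -> A t -> A (z - t).
  move=> [P FP ->] [Q FQ ->]; exists (P - Q); rewrite ?hornerE // => i.
  by rewrite coefB; apply: (subfieldB sF).
have AM z t : A z -> A t -> A (z * t).
  move=> [P FP ->] [Q FQ ->]; exists (P * Q); rewrite ?hornerE // => i.
  by rewrite coefM; apply: (subfield_sum _ sF) => j _; apply: (subfieldM sF).
have Afr z : A z -> fractions A z by move=> Az; apply: (fractions_sub A1 Az).
have FA : field_gen K (x |` S) `<=` fractions A.
  apply: field_gen_sub; first exact: subfield_fractions.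
  - move=> z Kz; apply: Afr; exists z%:P => [i|]; rewrite ?hornerE //.
    by rewrite coefC; case: eqP => _; [apply: sub_field_genl | apply: (subfield0 sF)].
  - move=> z [->|Sz]; apply: Afr.
      by exists 'X => [i|]; rewrite ?hornerE // coefX; apply: (subfield_nat _ sF).
    exists z%:P => [i|]; rewrite ?hornerE //.
    by rewrite coefC; case: eqP => _; [apply: sub_field_genr | apply: (subfield0 sF)].
have [b [Ab b0] bq] := fractions_common_denominator A1 AM (size q) (fun i => FA _ (Fq i)).
have [R FR RE] : exists2 R : nat -> {poly L}, (forall i j : nat, F (R i)`_j) &
    forall i, (R i).[x] = b * q`_i.
  have /choice[R HR] : forall i : nat, exists P : {poly L},
      (forall j : nat, F P`_j) /\ P.[x] = b * q`_i.
    move=> i; have [/bq[P FP ->]|qi] := ltnP i (size q); first by exists P.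
    by exists 0; split=> [j|]; rewrite ?coef0 ?hornerE ?nth_default ?mulr0 //;
      apply: (subfield0 sF).
  by exists R => i; have [] := HR i.
(* The cleared relation is the sum of the [R_i(x) y^i]; the value of [c k] at [y] is its coefficient
   at [x^k]. *)
pose n := size q; pose N := \max_(i < n) size (R i).
pose c k := \poly_(i < n) (R i)`_k.
have Fc k (i : nat) : F (c k)`_i.
  by rewrite coef_poly; case: ifP => _; [apply: FR | apply: (subfield0 sF)].
have [k ck] : exists k, c k != 0.
  have i_lt : (n.-1 < n)%N by rewrite prednK // size_poly_gt0.
  have : R n.-1 != 0.
    apply: contraTneq (mulf_neq0 b0 (_ : lead_coef q != 0)); last by rewrite lead_coef_eq0.
    by rewrite lead_coefE -RE => ->; rewrite horner0 eqxx.
  rewrite -lead_coef_eq0 lead_coefE => Rk; exists (size (R n.-1)).-1.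
  by apply: contraNneq Rk => /polyP/(_ n.-1); rewrite coef_poly i_lt coef0 => ->.
(* [c k] is a nonzero polynomial over [F], and [y] is not algebraic over [F]. *)
have ck0 : (c k).[y] != 0.
  by apply/negP => cky; apply: nSy; exists (c k); split=> //; apply: Fc.
have k_lt : (k < N)%N.
  rewrite ltnNge; apply: contraNN ck => leNk; apply/eqP/polyP => i.
  rewrite coef_poly coef0; case: ifP => // i_lt; apply: nth_default.
  by apply: leq_trans leNk; apply: (leq_bigmax (Ordinal i_lt)).
exists (\poly_(j < N) (c j).[y]); split.
- by apply: contraNneq ck0 => /polyP/(_ k); rewrite coef_poly k_lt coef0 => ->.
- move=> i; have sFy : subfield (field_gen K (y |` S)) by apply: field_gen_subfield.
  rewrite coef_poly; case: ifP => _; last exact: subfield0.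
  apply: (subfield_horner sFy) => [j|]; last by apply: sub_field_genr; left.
  by apply: (field_genS _ (Fc i j)); apply: subsetUr.
- rewrite rootE horner_poly.
  under eq_bigr do rewrite /c horner_poly mulr_suml.
  rewrite exchange_big /= (eq_bigr (fun i : 'I_n => b * (q`_i * y ^+ i))).
    by rewrite -mulr_sumr -horner_coef (rootP qy) mulr0.
  move=> i _; rewrite mulrA -RE (@horner_coef_wide _ N) ?mulr_suml.
    by apply: eq_bigr => j _; rewrite mulrAC.
  exact: (leq_bigmax i).
Qed.

End AlgebraicClosure.

(** * Independence for a closure operator with exchange *)

Section Pregeometry.
Variables (T : eqType) (cl : set T -> set T).
Hypotheses (sub_cl : forall S, S `<=` cl S)
  (cl_sub : forall S S', S `<=` cl S' -> cl S `<=` cl S')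
  (exchange : forall S x y, cl (x |` S) y -> ~ cl S y -> cl (y |` S) x).
Implicit Types s t : seq T.

(** Independence over [S] tested one entry at a time, each against [S] and the entries before it,
    which suits induction on lists. *)
Fixpoint prefix_indep (S : set T) s : Prop :=
  if s is x :: s' then ~ cl S x /\ prefix_indep (x |` S) s' else True.

Lemma cl_le S S' : S `<=` S' -> cl S `<=` cl S'.
Proof. by move=> SS'; apply: cl_sub => x /SS'; apply: sub_cl. Qed.

(** Steinitz replacement: each entry of [t] in turn takes the place of one entry of [s], which
    exchange makes redundant. *)
Lemma prefix_indep_size S t s :
  prefix_indep S t -> [set` t] `<=` cl (S `|` [set` s]) -> (size t <= size s)%N.
Proof.
elim: t => // y t IH in S s * => -[nSy indt] sub.
have : cl (S `|` [set` s]) y by apply: sub; rewrite /= mem_head.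
(* [z] is the first entry of [s] whose addition puts [y] into the closure; exchange recovers [z]
   from [y] and the entries before it. *)
have [s1 [z [s2 [sE zy]]]] : exists s1 z s2, s = s1 ++ z :: s2 /\
    cl (y |` (S `|` [set` s1])) z.
  have : cl (S `|` [set` s]) y by apply: sub; rewrite /= mem_head.
  elim/last_ind: s {sub} => [|s z IHs].
    by move=> c; case: nSy; apply: cl_le c => x [//|]; rewrite /= in_nil.
  have [/IHs[s1 [z' [s2 [-> c]]]] _|ny c] := pselect (cl (S `|` [set` s]) y).
    by exists s1, z', (rcons s2 z); rewrite rcons_cat.
  exists s, z, [::]; rewrite cats1; split=> //; apply: exchange => //.
  apply: cl_le c => x /= [Sx|]; first by right; left.
  by rewrite mem_rcons inE => /predU1P[->|xs]; [left|right; right].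
rewrite sE size_cat /= addnS ltnS -size_cat => _.
apply: (IH (y |` S)) => // x xt; have := sub x; rewrite sE /= inE xt orbT => /(_ isT).
apply: cl_sub => w /= [Sw|]; first by apply: sub_cl; left; right.
rewrite mem_cat inE => /or3P[ws|/eqP->|ws].
- by apply: sub_cl; right; rewrite /= mem_cat ws.
- apply: cl_le zy => v [->|[Sv|vs]]; first by left; left.
    by left; right.
  by right; rewrite /= mem_cat vs.
- by apply: sub_cl; right; rewrite /= mem_cat ws orbT.
Qed.

Lemma prefix_indepS S S' s : S `<=` S' -> prefix_indep S' s -> prefix_indep S s.
Proof.
elim: s => // x s IH in S S' * => SS' [nx] ind.
split; first by move=> Sx; apply: nx; apply: cl_le Sx.
by apply: IH ind => y [->|/SS' Sy]; [left | right].
Qed.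

Lemma prefix_indep_rcons S s x :
  prefix_indep S (rcons s x) <-> prefix_indep S s /\ ~ cl (S `|` [set` s]) x.
Proof.
elim: s => [|y s IH] in S *.
  have -> : S `|` [set` [::]] = S :> set T.
    by apply/seteqP; split=> z; [case | left].
  by split=> [[]|[]].
have -> : S `|` [set` y :: s] = (y |` S) `|` [set` s].
  apply/seteqP; split=> z.
  - case=> [|/=]; first by left; right.
    by rewrite inE => /predU1P[->|]; [left; left | right].
  - case=> [[->|]|/=]; first by right; rewrite /= mem_head.
      by left.
    by move=> zs; right; rewrite /= inE zs orbT. 
by rewrite /= IH; tauto.
Qed.

(* Scanning a list in increasing order and discarding every element that depends
   on smaller ones leaves an independent list with the same closure. *)
Lemma increasing_basis (I : eqType) (lt : rel I) (y : I -> T) (S : set T)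
    (s : seq I) :
  irreflexive lt -> (forall a b, lt a b -> ~~ lt b a) -> pairwise lt s ->
  let B := [seq i <- s | ~~ `[< cl (S `|` [set y j | j in [set j | j \in s /\ lt j i]]) (y i) >]] in
  prefix_indep S (map y B) /\ [set` map y s] `<=` cl (S `|` [set` map y B]).
Proof.
move=> ltxx lt_asym; elim: s S => [|x s IH] S; first by split.
move=> /= /andP[/allP ltx ps].
have SE : S `|` [set y j | j in [set j | j \in x :: s /\ lt j x]] = S.
  apply/seteqP; split=> z; last by left.
  case=> // -[j [/=]]; rewrite inE => /predU1P[->|js]; first by rewrite ltxx.
  by move=> jx; have := lt_asym _ _ jx; rewrite ltx.
rewrite SE.
have BE : [seq i <- s | ~~ `[< cl (S `|` [set y j | j in [set j | j \in x :: s /\ lt j i]])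
  (y i) >]]
   = [seq i <- s | ~~ `[< cl ((y x |` S) `|` [set y j | j in [set j | j \in s /\ lt j i]])
     (y i) >]].
  apply: eq_in_filter => i si; congr (~~ `[< cl _ _ >]).
  apply/seteqP; split=> z.
  - case=> [|[j [/=]]]; first by left; right.
    rewrite inE => /predU1P[-> _ <-|js ji <-]; first by left; left.
    by right; exists j.
  - case=> [[->|]|[j [/= js ji] <-]].
    + by right; exists x => //; split; [rewrite /= mem_head | apply: ltx].
    + by left.
    + by right; exists j => //; split; rewrite //= inE js orbT.
rewrite BE; have [ind span] := IH (y x |` S) ps.
set B := filter _ _ in ind span *.
case: asboolP => [Sx|nSx] /=.
- split; first by apply: prefix_indepS ind => z; right.
  move=> z /=; rewrite inE => /predU1P[->|zs].
    by apply: cl_le Sx => w; left.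
  apply: cl_sub (span z zs) => w [[->|Sw]|wB].
  + by apply: cl_le Sx => v; left.
  + by apply: sub_cl; left.
  + by apply: sub_cl; right.
- split=> // z /=; rewrite inE => /predU1P[->|zs].
    by apply: sub_cl; right; rewrite /= mem_head.
  apply: cl_le (span z zs) => w [[->|Sw]|wB].
  + by right; rewrite /= mem_head.
  + by left.
  + by right; rewrite /= inE wB orbT.
Qed.

Lemma prefix_indep_subseq S (s t : seq T) :
  subseq t s -> prefix_indep S s -> prefix_indep S t.
Proof.
elim: s => [|x s IH] in S t *; first by rewrite subseq0 => /eqP->.
case: t => [|y t] //= ts [nx ind]; move: ts; case: eqP => [-> ts|_ ts].
  by split=> //; apply: IH ind.
apply: (IH _ (y :: t)) => //; apply: prefix_indepS ind => z; by right.
Qed.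

(** A dependence in [t] is transported by [g] to a dependence in its image. *)
Lemma prefix_indep_map (g : T -> T) S (t : seq T) :
  (forall S' x, cl S' x -> cl (g @` S') (g x)) ->
  prefix_indep (g @` S) (map g t) -> prefix_indep S t.
Proof.
move=> gcl; elim: t => //= x t IH in S * => -[nx ind]; split.
  by move=> /gcl.
by apply: IH; rewrite image_setU image_set1.
Qed.

End Pregeometry.

Lemma widen_ord_lift n (i : 'I_n) : widen_ord (leqnSn n) i = lift ord_max i.
Proof. by apply: val_inj; rewrite /= /bump leqNgt ltn_ord. Qed.

(** * Polynomials in n + 1 variables as polynomials in the last one *)

Section Muni.
Variables (R : comNzRingType) (n : nat).
Local Notation wid := (widen_ord (leqnSn n)).
Implicit Types (q : {mpoly R[n.+1]}) (m : 'X_{1..n}).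

Definition mnm_rcons m (k : nat) : 'X_{1..n.+1} := [multinom of rcons m k].

Lemma mnm_rcons_max m k : mnm_rcons m k ord_max = k.
Proof. by rewrite (mnm_nth 0%N) /= nth_rcons size_tuple ltnn eqxx. Qed.

Lemma mnm_rcons_widen m k i : mnm_rcons m k (wid i) = m i.
Proof.
by rewrite !(mnm_nth 0%N) /= nth_rcons size_tuple ltn_ord.
Qed.

Lemma mnm_rconsP (w : 'X_{1..n.+1}) :
  w = mnm_rcons [multinom w (wid i) | i < n] (w ord_max).
Proof.
apply/mnmP => i; case: (unliftP ord_max i) => [j ->|->].
  by rewrite -widen_ord_lift mnm_rcons_widen mnmE.
by rewrite mnm_rcons_max.
Qed.

Lemma mnm_rcons_inj m m' k k' :
  mnm_rcons m k = mnm_rcons m' k' -> m = m' /\ k = k'.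
Proof.
move=> E; split; last by rewrite -(mnm_rcons_max m k) E mnm_rcons_max.
by apply/mnmP => i; rewrite -(mnm_rcons_widen m k) E mnm_rcons_widen.
Qed.

Lemma coef_muni q k m : ((muni q)`_k)@_m = q@_(mnm_rcons m k).
Proof.
rewrite muniE coef_sum raddf_sum /=.
have F w : ((q@_w *: 'X_[[multinom w (wid i) | i < n]] *: 'X^(w ord_max))`_k)@_m
   = q@_w * (w == mnm_rcons m k)%:R.
  rewrite coefZ coefXn; have [->|nw] := eqVneq w (mnm_rcons m k).
    rewrite mnm_rcons_max eqxx !mulr1 mcoeffZ mcoeffX.
    rewrite (_ : [multinom _ | i < n] = m) ?eqxx ?mulr1 //.
    by apply/mnmP => i; rewrite mnmE mnm_rcons_widen.
  rewrite mulr0; have [kE|_] := eqVneq k; last by rewrite mulr0 mcoeff0.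
  rewrite mulr1 mcoeffZ mcoeffX; case: eqP => [mE|]; last by rewrite mulr0.
  by rewrite [w]mnm_rconsP mE kE eqxx in nw.
under eq_bigr do rewrite F.
have [qs|qs] := boolP (mnm_rcons m k \in msupp q).
  rewrite (bigD1_seq (mnm_rcons m k)) ?msupp_uniq //= eqxx mulr1 big1 ?addr0 //.
  by move=> w /negPf ->; rewrite mulr0.
rewrite (memN_msupp_eq0 qs) big_seq big1 // => w wq.
case: eqP => [E|_]; last by rewrite mulr0.
by rewrite -E wq in qs.
Qed.

Lemma muni_eq0 q : muni q = 0 -> q = 0.
Proof.
move=> q0; apply/mpolyP => w; rewrite [w]mnm_rconsP -coef_muni q0.
by rewrite coef0 !mcoeff0.
Qed.

Lemma horner_muni q (x : 'I_n.+1 -> R) :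
  q.@[x] = (map_poly (meval (x \o wid)) (muni q)).[x ord_max].
Proof.
rewrite mevalE muniE rmorph_sum horner_sum; apply: eq_bigr => w _ /=.
rewrite -mul_polyC rmorphM /= map_polyC map_polyXn hornerM hornerC hornerXn /=.
rewrite mevalZ mevalX big_ord_recr /= mulrA; congr (_ * _ * _).
by apply: eq_bigr => i _; rewrite mnmE.
Qed.

(** Used to read a univariate relation with polynomial coefficients as a relation in one more
    variable. *)
Lemma muni_surj (r : nat -> {mpoly R[n]}) d :
  exists q : {mpoly R[n.+1]}, muni q = \poly_(k < d) r k.
Proof.
exists (\sum_(k < d) \sum_(m <- msupp (r k)) (r k)@_m *: 'X_[mnm_rcons m k]).
apply/polyP => k; apply/mpolyP => m; rewrite coef_muni coef_poly raddf_sum /=.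
have F (i : 'I_d) : (\sum_(w <- msupp (r i)) (r i)@_w *: 'X_[mnm_rcons w i])@_(mnm_rcons m k)
   = (r i)@_m * (i == k :> nat)%:R.
  rewrite raddf_sum /=; under eq_bigr do rewrite mcoeffZ mcoeffX.
  case: eqVneq => [<-|ik].
    rewrite mulr1; under eq_bigr => w _.
      have -> : (mnm_rcons w i == mnm_rcons m i) = (w == m).
        by apply/eqP/eqP => [/mnm_rcons_inj[]|->].
      over.
    rewrite [in RHS](mpolyE (r i)) raddf_sum /=.
    by apply: eq_bigr => w _; rewrite mcoeffZ mcoeffX.
  rewrite mulr0 big1 // => w _; case: eqP => [/mnm_rcons_inj[_ E]|]; last by rewrite mulr0.
  by rewrite E eqxx in ik.
under eq_bigr do rewrite F.
case: ltnP => [kd|dk].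
  rewrite (bigD1 (Ordinal kd)) //= eqxx mulr1 big1 ?addr0 // => i ik.
  by rewrite (_ : (i == k :> nat) = false) ?mulr0 //; apply: negPf.
rewrite mcoeff0 big1 // => i _; case: eqP => [E|]; last by rewrite mulr0.
by have := ltn_ord i; rewrite E ltnNge dk.
Qed.

End Muni.

(** * Transcendence degree as a rank *)

Section Trdeg.
Variables (L : fieldType) (K : set L).
Hypothesis sK : subfield K.

Local Notation indep := (prefix_indep (acl K) set0).

(** A relation in n + 1 variables is a univariate relation for the last element over polynomials in
    the others. Conversely, clearing denominators turns algebraicity over the generated field into
    such a relation. *)
Lemma alg_indep_recr n (x : 'I_n.+1 -> L) :
  let x' := x \o widen_ord (leqnSn n) in
  alg_indep K x <-> alg_indep K x' /\ ~ acl K (range x') (x ord_max).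
Proof.
move=> x'; pose A := [set z | exists2 q : {mpoly L[n]}, (forall m, K q@_m) & z = q.@[x']].
have A1 : A 1.
  exists 1; last by rewrite meval1.
  by move=> m; rewrite mcoeff1; apply: subfield_nat.
have AB z t : A z -> A t -> A (z - t).
  move=> [P FP ->] [Q FQ ->]; exists (P - Q); rewrite ?mevalB // => m.
  by rewrite mcoeffB; apply: subfieldB.
have AM z t : A z -> A t -> A (z * t).
  move=> [P FP ->] [Q FQ ->]; exists (P * Q); rewrite ?mevalM // => m.
  rewrite mcoeffM; apply: subfield_sum => // w _; exact: subfieldM.
have Afr z : A z -> fractions A z by move=> Az; apply: (fractions_sub A1 Az).
have KA z : K z -> A z.
  move=> Kz; exists z%:MP; rewrite ?mevalC // => m.
  by rewrite mcoeffC; apply: subfieldM => //; apply: subfield_nat.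
have xA i : A (x' i).
  exists 'X_i; rewrite ?mevalXU // => m; rewrite mcoeffX; exact: subfield_nat.
have FA : field_gen K (range x') `<=` fractions A.
  apply: field_gen_sub; first exact: subfield_fractions.
  - by move=> z Kz; apply/Afr/KA.
  - by move=> z [i _ <-]; apply: Afr.
have AF : A `<=` field_gen K (range x').
  move=> z [q Kq ->]; have sF := field_gen_subfield K (range x').
  rewrite mevalE; apply: (subfield_sum _ sF) => m _; apply: (subfieldM sF).
    exact: sub_field_genl.
  apply: (subfield_prod _ sF) => i _; apply: (subfieldX _ sF).
  by apply: sub_field_genr; exists i.
split=> [indx|[indx' nx] q Kq qx].
- split=> [q Kq qx|[q [q0 Fq qx]]].
    (* The relation [q] is read as one in n + 1 variables, constant in the last. *)
    have [Q QE] := muni_surj (fun=> q) 1.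
    have /indx Q0 : forall m, K Q@_m.
      move=> m; rewrite [m]mnm_rconsP -coef_muni QE coef_poly.
      by case: ifP => _; rewrite ?Kq // mcoeff0; apply: subfield0.
    have : (muni Q)`_0 = 0.
      rewrite Q0 ?muni0 ?coef0 // horner_muni QE.
      rewrite (_ : \poly_(_ < 1) q = q%:P); first by rewrite map_polyC hornerC /= qx.
      by apply/polyP => k; rewrite coef_poly coefC; case: k.
    by rewrite QE coef_poly.
  have [b [Ab b0] bq] := fractions_common_denominator A1 AM (size q) (fun i => FA _ (Fq i)).
  have /choice[r Hr] : forall i : nat, exists P : {mpoly L[n]},
      (forall m, K P@_m) /\ P.@[x'] = b * q`_i.
    move=> i; have [/bq[P FP ->]|qi] := ltnP i (size q); first by exists P.
    exists 0; split=> [m|]; first by rewrite mcoeff0; apply: subfield0.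
    by rewrite meval0 nth_default ?mulr0.
  have [Q QE] := muni_surj r (size q).
  have /indx Q0 : forall m, K Q@_m.
    move=> m; rewrite [m]mnm_rconsP -coef_muni QE coef_poly.
    by case: ifP => _; [apply: (Hr _).1 | rewrite mcoeff0; apply: subfield0].
  have : \poly_(k < size q) r k = 0.
    rewrite -QE Q0 ?muni0 // horner_muni QE.
    rewrite (_ : map_poly _ _ = b *: q) ?hornerZ ?(rootP qx) ?mulr0 //.
    apply/polyP => k; rewrite coef_map coef_poly coefZ /=.
    by case: ltnP => [_|?]; rewrite ?(Hr k).2 // raddf0 nth_default ?mulr0.
  have sq : ((size q).-1 < size q)%N by rewrite prednK // size_poly_gt0.
  move=> /polyP/(_ (size q).-1); rewrite coef_poly coef0 sq => r0.
  have := (Hr (size q).-1).2; rewrite r0 meval0 => /esym/eqP.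
  by rewrite mulf_eq0 (negPf b0) -lead_coefE lead_coef_eq0 (negPf q0).
- apply: muni_eq0; apply/polyP => k; rewrite coef0; apply: indx' => [m|].
    by rewrite coef_muni; apply: Kq.
  (* Were some coefficient nonzero at [x'], the specialized polynomial would make the last element
     algebraic over the others. *)
  apply/eqP; apply: contra_notT nx => qk; exists (map_poly (meval x') (muni q)).
  split.
  + by apply: contraNneq qk => /polyP/(_ k); rewrite coef_map coef0 /= => ->.
  + move=> i; rewrite coef_map /=; apply: AF; exists (muni q)`_i => // m.
    by rewrite coef_muni; apply: Kq.
  + by rewrite rootE -horner_muni qx.
Qed.

Lemma alg_indep_prefix (s : seq L) :
  alg_indep K (fun i : 'I_(size s) => s`_i) <-> indep s.
Proof.
elim/last_ind: s => [|s x IH].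
  split=> // _ q Kq; rewrite [q]nvar0_mpolyC mevalC => ->.
  by rewrite mpolyC0.
rewrite size_rcons alg_indep_recr prefix_indep_rcons -IH set0U.
set x1 := (fun i : 'I_(size s).+1 => _).
have -> : x1 \o widen_ord (leqnSn (size s)) = (fun i : 'I_(size s) => s`_i).
  by apply/funext => i; rewrite /x1 /= nth_rcons ltn_ord.
rewrite nth_rcons ltnn eqxx.
suff -> : [set s`_i | i in [set: 'I_(size s)]] = [set` s] by [].
apply/seteqP; split=> z /=; first by move=> [i _ <-]; apply: mem_nth.
by move=> zs; have zi := zs; rewrite -index_mem in zi; exists (Ordinal zi); rewrite //= nth_index.
Qed.

(** Passes from indexed families to lists, where transcendence bases are bases for the closure
    [acl K]. *)
Lemma has_trdegP (F : set L) d :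
  has_trdeg K F d <->
  exists xs : seq L, [/\ size xs = d, [set` xs] `<=` F, indep xs & F `<=` acl K [set` xs]].
Proof.
have rangeE d' (x : 'I_d' -> L) : range x = [set` codom x].
  apply/seteqP; split=> z /=; first by move=> [i _ <-]; apply: codom_f.
  by case/codomP=> i ->; exists i.
split.
- case=> x [Fx indx Falg]; exists (codom x); split.
  + by rewrite size_codom card_ord.
  + by move=> z; rewrite -rangeE => -[i _ <-].
  + apply/alg_indep_prefix; rewrite size_codom card_ord.
    suff -> : (fun i : 'I_d => (codom x)`_i) = x by [].
    by apply/funext => i; rewrite (nth_map i) ?nth_ord_enum // size_enum_ord.
  + by move=> y Fy; rewrite -rangeE; apply: Falg.
- case=> xs [<- xsF indx Falg]; exists (fun i : 'I_(size xs) => xs`_i); split.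
  + by move=> i; apply/xsF/mem_nth.
  + exact/alg_indep_prefix.
  + move=> y /Falg; rewrite /acl; suff -> : [set` xs] = range (fun i : 'I_(size xs) => xs`_i) by [].
    apply/seteqP; split=> z /=; last by move=> [i _ <-]; apply: mem_nth.
    by move=> zs; have zi := zs; rewrite -index_mem in zi; exists (Ordinal zi);
      rewrite //= nth_index.
Qed.

Lemma indep_size_le (t s : seq L) :
  indep t -> [set` t] `<=` acl K [set` s] -> (size t <= size s)%N.
Proof.
move=> indt ts.
apply: (prefix_indep_size (@sub_acl _ K) (@acl_sub _ K) (@acl_exchange _ K) indt).
by rewrite set0U.
Qed.

Lemma has_trdeg_le (F F' : set L) d d' :
  has_trdeg K F d -> has_trdeg K F' d' -> F `<=` acl K F' -> (d <= d')%N.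
Proof.
move=> /has_trdegP[xs [<- xsF ind _]] /has_trdegP[ys [<- ysF _ F'ys]] FF'.
apply: indep_size_le => // z /xsF/FF'; exact: acl_sub.
Qed.

End Trdeg.

(** * Derivations and automorphisms acting on algebraic relations *)

Section Operators.
Variables (L : fieldType) (K : set L).
Implicit Types (S T F : set L).

Section Derivation.
Variable d : {additive L -> L}.
Hypothesis dM : forall x y, d (x * y) = d x * y + x * d y.

Lemma derivation1 : d 1 = 0.
Proof. by have := dM 1 1; rewrite !mul1r mulr1 => /(canLR (addrK _)); rewrite subrr. Qed.

Lemma derivation_div x y : y != 0 -> d (x / y) = (d x - x / y * d y) / y.
Proof.
move=> y0; have := dM (x / y) y; rewrite divfK // => ->.
by rewrite addrK mulfK.
Qed.

Lemma derivation_field_gen S F :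
    subfield F -> field_gen K S `<=` F -> (forall x, K x -> F (d x)) ->
    (forall x, S x -> F (d x)) ->
  forall x, field_gen K S x -> F (d x).
Proof.
move=> sF KSF dK dS; pose G := [set x | F x /\ F (d x)].
suff : field_gen K S `<=` G by move=> KSG x /KSG[].
apply: field_gen_sub.
- split.
  + by split; [apply: subfield1 | rewrite derivation1; apply: subfield0].
  + by move=> x y [Fx Fdx] [Fy Fdy]; rewrite /G /= raddfB; split; apply: subfieldB.
  + move=> x y [Fx Fdx] [Fy Fdy]; split; first exact: subfield_div.
    have [->|y0] := eqVneq y 0; first by rewrite invr0 mulr0 raddf0; apply: subfield0.
    rewrite derivation_div //; apply: subfield_div => //; apply: subfieldB => //.
    by apply: subfieldM => //; apply: subfield_div.
- by move=> x Kx; split; [apply: KSF; apply: sub_field_genl | apply: dK].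
- by move=> x Sx; split; [apply: KSF; apply: sub_field_genr | apply: dS].
Qed.

Lemma derivation_horner (q : {poly L}) x :
  d q.[x] = (map_poly d q).[x] + q^`().[x] * d x.
Proof.
elim/poly_ind: q => [|q c IH]; first by rewrite deriv0 map_poly0 !horner0 raddf0 mul0r addr0.
rewrite hornerMXaddC raddfD /= dM IH derivMXaddC !hornerE.
have -> : map_poly d (q * 'X + c%:P) = map_poly d q * 'X + (d c)%:P.
  apply/polyP => i; rewrite coef_map_id0 ?raddf0 // !coefD !coefMX !coefC raddfD /=.
  by case: i => [|i] /=; rewrite ?raddf0 // coef_map_id0 ?raddf0.
by rewrite !hornerE; ring.
Qed.

Hypotheses (charL0 : [pchar L] =i pred0) (dK : forall x, K x -> K (d x)).

(** Differentiating a minimal relation [q] gives [0 = q^d(x) + q'(x) d x], where [q^d] has the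
    differentiated coefficients; hence [d x] is a quotient of elements algebraic over [S] and its
    image under [d]. *)
Lemma derivation_acl S x :
  acl K S x -> acl K (S `|` d @` S) (d x).
Proof.
move=> aSx.
have [q [q0 Sq qx qmin]] : exists q : {poly L}, [/\ q != 0,
    (forall i : nat, field_gen K S q`_i), root q x &
    forall r : {poly L}, r != 0 -> (forall i : nat, field_gen K S r`_i) ->
      (size r < size q)%N -> ~~ root r x].
  case: aSx => q; move: {2}(size q) (leqnn (size q)) => k.
  elim: k q => [|k IH] q qk [q0 Sq qx].
    by move: qk; rewrite leqn0 size_poly_eq0 (negPf q0).
  have [[r [r0 Sr rq rx]]|nr] := pselect (exists r : {poly L}, [/\ r != 0,
     forall i : nat, field_gen K S r`_i, (size r < size q)%N & root r x]).
    by apply: (IH r) => //; rewrite -ltnS; apply: leq_trans qk.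
  exists q; split=> // r r0 Sr rq; apply/negP => rx.
  by apply: nr; exists r.
(* Characteristic zero keeps [q'] nonzero, and the minimality of [q] then forbids the root [x]. *)
have q'x : q^`().[x] != 0.
  apply: qmin.
  - have qs : (0 < (size q).-1)%N by have := root_size_gt1 q0 qx; case: size => [|[]].
    apply/eqP => /polyP/(_ (size q).-2); rewrite coef_deriv coef0 prednK //.
    move/eqP; rewrite -mulr_natr mulf_eq0 -lead_coefE lead_coef_eq0 (negPf q0) /=.
    by rewrite ((pcharf0P L).1 charL0) => /eqP qs0; rewrite qs0 in qs.
  - move=> i; rewrite coef_deriv -mulr_natr; have sF := field_gen_subfield K S.
    by apply: (subfieldM sF) => //; apply: (subfield_nat _ sF).
  - exact: lt_size_deriv.
have sA := acl_subfield K (S `|` d @` S).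
have SA : field_gen K S `<=` acl K (S `|` d @` S).
  by apply: sub_acl_field_gen => y Sy; apply: sub_acl; left.
have xA : acl K (S `|` d @` S) x by apply: aclS aSx => y; left.
have -> : d x = - (map_poly d q).[x] / q^`().[x].
  apply: (mulIf q'x); rewrite divfK // mulrC; apply/eqP.
  by rewrite -addr_eq0 addrC -derivation_horner (rootP qx) raddf0.
apply: subfield_div => //; first apply: subfieldN => //.
- apply: subfield_horner => // i; rewrite coef_map_id0 ?raddf0 //.
  apply: (derivation_field_gen sA SA) (Sq i) => y ?.
    by apply: field_gen_acl; apply: sub_field_genl; apply: dK.
  by apply: sub_acl; right; exists y.
- apply: subfield_horner => // i; rewrite coef_deriv -mulr_natr.
  by apply: subfieldM => //; [apply: SA | apply: subfield_nat].
Qed.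

End Derivation.

Section Morphism.
Variable f : {rmorphism L -> L}.
Hypothesis fK : forall x, K x -> K (f x).

Lemma morphism_field_gen S x :
  field_gen K S x -> field_gen K (f @` S) (f x).
Proof.
have sF := field_gen_subfield K (f @` S).
suff : field_gen K S `<=` [set x | field_gen K (f @` S) (f x)] by apply.
apply: field_gen_sub.
- split=> [|y z Fy Fz|y z Fy Fz] /=.
  + by rewrite rmorph1; apply: (subfield1 sF).
  + by rewrite rmorphB; apply: (subfieldB sF).
  + by rewrite fmorph_div; apply: (subfield_div sF).
- by move=> y /fK; apply: sub_field_genl.
- by move=> y Sy; apply: sub_field_genr; exists y.
Qed.

Lemma morphism_acl S x : acl K S x -> acl K (f @` S) (f x).
Proof.
move=> [q [q0 Sq qx]]; exists (map_poly f q); split.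
- by rewrite map_poly_eq0.
- by move=> i; rewrite coef_map; apply: morphism_field_gen.
- exact: rmorph_root.
Qed.

End Morphism.

End Operators.

(** * Power products as monomials *)

Section BigComp.
Variables (T : Type) (I : eqType).
Implicit Types (f g : I -> T -> T) (o : T -> T).
Local Notation bigcomp s F := (\big[(fun f g : T -> T => f \o g)/id]_(i <- s) F i).

Lemma bigcomp_comm s f o :
  (forall i z, f i (o z) = o (f i z)) -> forall z, bigcomp s f (o z) = o (bigcomp s f z).
Proof.
by move=> fo z; elim: s => [|i s IH]; rewrite ?big_nil // !big_cons /= IH.
Qed.

(** The extra factor [o] at the single index [i0] commutes past the factors in front of it. *)
Lemma bigcomp_step s f g o i0 : uniq s -> i0 \in s ->
    (forall i z, i != i0 -> g i z = f i z) -> (forall z, g i0 z = o (f i0 z)) ->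
    (forall i z, f i (o z) = o (f i z)) ->
  forall z, bigcomp s g z = o (bigcomp s f z).
Proof.
move=> us is0 gf gf0 fo z; elim: s us is0 => //= i s IH /andP[nis us].
rewrite inE !big_cons /= => /predU1P[E|is0].
  subst i; rewrite gf0; congr (o (f i0 _)).
  elim: s nis {us IH} => [|i s IH]; first by rewrite !big_nil.
  by rewrite inE negb_or eq_sym !big_cons /= => /andP[ii /IH ->]; rewrite gf.
rewrite IH // -fo gf //; by apply: contraNneq nis => ->.
Qed.

End BigComp.

Section Multidegree.
Variables (Z : finType) (q : nat) (kd : Z -> 'I_q).
Implicit Types (v w : {ffun Z -> nat}) (x : Z).

Definition madd v w : {ffun Z -> nat} := [ffun z => v z + w z]%N.
Definition mincr x v : {ffun Z -> nat} := [ffun y => v y + (y == x)]%N.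
Definition mle v w : bool := [forall z, v z <= w z]%N.
Definition mdegree v : {ffun 'I_q -> nat} := [ffun k => \sum_(x | kd x == k) v x]%N.

Lemma mleP v w : reflect (forall z, v z <= w z)%N (mle v w).
Proof. exact: forallP. Qed.

Lemma mdegreeD v w k : mdegree (madd v w) k = (mdegree v k + mdegree w k)%N.
Proof. by rewrite !ffunE -big_split; apply: eq_bigr => z _; rewrite ffunE. Qed.

Lemma mdegree_mincr x v k : mdegree (mincr x v) k = (mdegree v k + (k == kd x))%N.
Proof.
rewrite !ffunE (eq_bigr (fun z => v z + (z == x))%N) => [|z _]; last by rewrite ffunE.
rewrite big_split /=; congr (_ + _)%N; case: eqP => [->|E].
  by rewrite (bigD1 x) //= eqxx big1 // => z /andP[_ /negPf->].
by rewrite big1 // => z /eqP zk; case: eqP => // zx; case: E; rewrite -zk zx.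
Qed.

Lemma leq_mdegree v z : (v z <= mdegree v (kd z))%N.
Proof. by rewrite ffunE (bigD1 z) //= leq_addr. Qed.

(** Induction on the total degree: a [w] above [v] and different from it exceeds [v] at some [x],
    where one unit can be removed. *)
Lemma mincr_ind (P : {ffun Z -> nat} -> Prop) v :
  P v -> (forall x w, mle v w -> P w -> P (mincr x w)) -> forall w, mle v w -> P w.
Proof.
move=> Pv Pi w; move: {2}(\sum_z w z)%N (leqnn (\sum_z w z)) => N.
elim: N w => [|N IH] w wN vw.
  suff -> : w = v by [].
  apply/ffunP => z; apply/eqP; rewrite eqn_leq (mleP _ _ vw) andbT.
  suff -> : w z = 0%N by [].
  by apply/eqP; rewrite -leqn0 (leq_trans _ wN) // (bigD1 z) //= leq_addr.
have [/mleP wv|/forallPn[x]] := boolP (mle w v).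
  suff -> : w = v by [].
  by apply/ffunP => z; apply/eqP; rewrite eqn_leq wv (mleP _ _ vw).
rewrite -ltnNge => vx; pose w' := [ffun z => w z - (z == x)]%N : {ffun Z -> nat}.
have wE : w = mincr x w'.
  apply/ffunP => z; rewrite !ffunE; case: eqP => [->|_]; last by rewrite subn0 addn0.
  by rewrite subnK // (leq_ltn_trans _ vx).
have vw' : mle v w'.
  apply/mleP => z; rewrite ffunE; case: eqP => [->|_]; last by rewrite subn0; apply: (mleP _ _ vw).
  by rewrite subn1 -ltnS prednK // (leq_ltn_trans _ vx).
rewrite wE; apply: (Pi) => //; apply: IH => //; rewrite -ltnS.
apply: leq_trans wN; rewrite wE [X in (_ < X)%N](eq_bigr (fun z => w' z + (z == x))%N).
  by rewrite big_split /= -[X in (_ < _ + X)%N]big_mkcond /= big_pred1_eq addn1.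
by move=> z _; rewrite ffunE.
Qed.

End Multidegree.

Arguments mle {Z} v w.

Section PowerProductAction.
Variables (m n : nat) (R : comNzRingType) (D : dsStructure m n R).
Implicit Types (z : R).

(** An automorphism and its inverse are two letters, so that words are monomials with natural
    exponents; [pp_of] performs the cancellation. *)
Definition operator : finType := ('I_m + ('I_n + 'I_n))%type.

Definition op_act (x : operator) : R -> R :=
  match x with
  | inl i => der D i
  | inr (inl j) => aut D j
  | inr (inr j) => auti D j
  end.

Definition pp_of (v : {ffun operator -> nat}) : power_product m n :=
  ([ffun i => v (inl i)],
   [ffun j => (v (inr (inl j)))%:Z - (v (inr (inr j)))%:Z]).

Let iter_comm (f g : R -> R) k :
  (forall z, f (g z) = g (f z)) -> forall z, iter k f (g z) = g (iter k f z).
Proof. by move=> fg z; elim: k => //= k ->. Qed.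

Lemma auti_comm j (f : R -> R) :
  (forall z, f (aut D j z) = aut D j (f z)) -> forall z, f (auti D j z) = auti D j (f z).
Proof.
by move=> fj z; apply: (can_inj (autK D j)); rewrite -fj !autiK.
Qed.

Lemma op_act_aut x j z : op_act x (aut D j z) = aut D j (op_act x z).
Proof.
case: x => [i|[i|i]] /=; [exact: der_autC | exact: aut_autC|].
by apply/esym/auti_comm => w; exact: aut_autC.
Qed.

Lemma op_act_auti x j z : op_act x (auti D j z) = auti D j (op_act x z).
Proof. by apply: auti_comm => w; apply: op_act_aut. Qed.

Lemma aut_pow_comm j l (f : R -> R) :
  (forall z, f (aut D j z) = aut D j (f z)) ->
  forall z, aut_pow D j l (f z) = f (aut_pow D j l z).
Proof.
move=> fj z; case: l => k; apply: (iter_comm _) => w; first by rewrite fj.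
by rewrite auti_comm.
Qed.

Lemma aut_powD1 j l z : aut_pow D j (l + 1) z = aut D j (aut_pow D j l z).
Proof.
case: l => k; first by rewrite -PoszD addn1.
have -> : Negz k + 1 = - k%:Z by rewrite NegzE; ring.
by case: k => [|k]; rewrite -?NegzE /= autiK.
Qed.

Lemma aut_powB1 j l z : aut_pow D j (l - 1) z = auti D j (aut_pow D j l z).
Proof. by rewrite -{2}[l](subrK 1) aut_powD1 autK. Qed.

Lemma pp_act_mincr x v z :
  pp_act D (pp_of (mincr x v)) z = op_act x (pp_act D (pp_of v) z).
Proof.
have derC (o : R -> R) : (forall i w, der D i (o w) = o (der D i w)) ->
    forall k : 'I_m -> nat, forall w,
    (\big[(fun f g : R -> R => f \o g)/id]_(i < m) iter (k i) (der D i)) (o w) =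
    o ((\big[(fun f g : R -> R => f \o g)/id]_(i < m) iter (k i) (der D i)) w).
  move=> oC k w; apply: bigcomp_comm => i y; exact: iter_comm.
have derE x' w : (forall i, mincr x' v (inl i) = v (inl i)) ->
    (\big[(fun f g : R -> R => f \o g)/id]_(i < m) iter ((pp_of (mincr x' v)).1 i) (der D i)) w =
    (\big[(fun f g : R -> R => f \o g)/id]_(i < m) iter ((pp_of v).1 i) (der D i)) w.
  by move=> xv; congr (_ w); apply: eq_bigr => i _; rewrite /= [X in iter X]ffunE xv ffunE.
rewrite /pp_act; case: x => [i|[j|j]].
- set w := (\big[_/_]_(j < n) _) z; set w' := (\big[_/_]_(j < n) _) z.
  have -> : w = w'.
    rewrite /w /w'; congr (_ z); apply: eq_bigr => j _.
    by congr (aut_pow D j _); rewrite !ffunE /= !addn0.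
  apply: (@bigcomp_step _ _ _ _ _ _ i); rewrite ?index_enum_uniq ?mem_index_enum //.
  + by move=> k y ki; rewrite !ffunE /= (inj_eq inl_inj) (negPf ki) addn0.
  + by move=> y; rewrite !ffunE eqxx addn1.
  + by move=> k y; apply: iter_comm => t; apply: der_derC.
- rewrite derE => [|i]; last by rewrite !ffunE addn0.
  rewrite -derC /=; last by move=> i w; apply: der_autC.
  congr (_ _).
  apply: (@bigcomp_step _ _ _ _ _ _ j); rewrite ?index_enum_uniq ?mem_index_enum //.
  + by move=> k y kj; rewrite !ffunE /= (inj_eq inr_inj) (inj_eq inl_inj) (negPf kj) !addn0.
  + move=> y; rewrite !ffunE eqxx addn0 -aut_powD1.
    by congr (aut_pow D j _ y); rewrite /=; lia.
  + by move=> k y; apply: aut_pow_comm => t; apply: aut_autC.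
- rewrite derE => [|i]; last by rewrite !ffunE addn0.
  rewrite -derC /=; last by move=> i w; apply: (op_act_auti (inl i)).
  congr (_ _).
  apply: (@bigcomp_step _ _ _ _ _ _ j); rewrite ?index_enum_uniq ?mem_index_enum //.
  + by move=> k y kj; rewrite !ffunE /= !(inj_eq inr_inj) (negPf kj) !addn0.
  + move=> y; rewrite !ffunE eqxx addn0 -aut_powB1.
    by congr (aut_pow D j _ y); rewrite /=; lia.
  + by move=> k y; apply: aut_pow_comm => t; apply/esym/auti_comm => s; apply: aut_autC.
Qed.

Lemma op_act_mul_inv j z : op_act (inr (inl j)) (op_act (inr (inr j)) z) = z.
Proof. exact: autiK. Qed.

End PowerProductAction.

(** * Blocks of derivations and orders of power products *)

Section Orders.
Variables (m n p : nat) (mm : 'I_p -> nat).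
Hypothesis sum_mm : (\sum_(k < p) mm k)%N = m.

Lemma in_block_uniq (nu : 'I_m) k k' : in_block mm k nu -> in_block mm k' nu -> k = k'.
Proof.
wlog lekk' : k k' / (k <= k')%N.
  move=> W kn kn'; have [le|/ltnW le] := leqP k k'; first exact: W.
  by apply/esym/W.
move=> /andP[_ nk] /andP[nk' _]; apply/val_inj/eqP; rewrite eqn_leq lekk' /= leqNgt.
apply/negP => lt; have := leq_ltn_trans nk' nk; rewrite ltnNge => /negP; apply.
rewrite [X in (_ <= X)%N](bigID (fun i : 'I_p => i <= k)%N) /=.
apply: leq_trans (leq_addr _ _); apply: eq_leq; apply: eq_bigl => i.
by rewrite andb_idl // => /leq_ltn_trans->.
Qed.

Lemma in_block_exists (nu : 'I_m) : exists k, in_block mm k nu.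
Proof.
pose c j := (\sum_(i < p | i < j) mm i)%N.
have ex : exists j, (nu < c j)%N.
  exists p; rewrite /c (eq_bigl xpredT) ?sum_mm // => i; exact: ltn_ord.
(* [j.+1] is the first index whose partial sum of block sizes exceeds [nu], so [nu] lies in block
   [j]. *)
case: (ex_minnP ex) => -[|j]; first by rewrite /c big1.
move=> nj jmin; have cj : (c j <= nu)%N by rewrite leqNgt; apply/negP => /jmin; rewrite ltnn.
have jp : (j < p)%N.
  rewrite ltnNge; apply/negP => pj; move: nj; rewrite ltnNge => /negP; apply.
  apply: leq_trans cj; apply: eq_leq; apply: eq_bigl => i.
  by rewrite ltnS [RHS](leq_trans (ltn_ord i) pj) ltnW // (leq_trans (ltn_ord i) pj).
by exists (Ordinal jp); rewrite /in_block cj.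
Qed.

Lemma card_in_block k : #|[pred nu : 'I_m | in_block mm k nu]| = mm k.
Proof.
set a := (\sum_(i < p | i < k) mm i)%N; set b := (\sum_(i < p | i <= k) mm i)%N.
have bE : b = (a + mm k)%N.
  rewrite /b (bigD1 k) //= addnC; congr (_ + _)%N; apply: eq_bigl => i.
  by rewrite ltn_neqAle andbC.
have bm : (b <= m)%N by rewrite -sum_mm [X in (_ <= X)%N](bigID (fun i : 'I_p => i <= k)%N)
  leq_addr.
have am : (a <= b)%N by rewrite bE leq_addr.
rewrite -sum1_card -(big_mkord (fun nu => (a <= nu < b)%N) (fun=> 1%N)).
rewrite (big_cat_nat (leq0n a) (leq_trans am bm)) (big_cat_nat am bm) /=.
rewrite big_nat_cond big_pred0 => [|i]; last by case: (leqP a i).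
rewrite [X in (_ + (_ + X))%N]big_nat_cond [X in (_ + (_ + X))%N]big_pred0 => [|i].
  rewrite add0n addn0 big_nat_cond (eq_bigl (fun i => (a <= i < b)%N && true)) => [|i].
    by rewrite -big_nat_cond sum_nat_const_nat muln1 bE addKn.
  by rewrite andbb andbT.
by case: (ltnP i b) => //; rewrite !andbF.
Qed.

(** The component of the multidegree to which a letter contributes. Under [sum_mm] every derivation
    lies in a block and takes the first branch. *)
Definition op_kind (x : operator m n) : 'I_p.+1 :=
  if x is inl nu then
    if [pick k | in_block mm k nu] is Some k then lift ord_max k else ord_max
  else ord_max.

Lemma op_kind_der nu k : (op_kind (inl nu) == lift ord_max k) = in_block mm k nu.
Proof.
rewrite /op_kind; case: pickP => [k' kn|nk].
  rewrite (inj_eq lift_inj); apply/eqP/idP => [<-//|]; exact: in_block_uniq.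
by have [k' kn] := in_block_exists nu; rewrite nk in kn.
Qed.

Local Notation deg := (mdegree op_kind).

Lemma mdegree_op_der v k :
  deg v (lift ord_max k) = (\sum_(nu < m | in_block mm k nu) v (inl nu))%N.
Proof.
rewrite ffunE big_sumType /= [X in (_ + X)%N]big1 ?addn0 => [|x]; last first.
  by rewrite (negPf (neq_lift _ _)).
by apply: eq_bigl => nu; rewrite op_kind_der.
Qed.

Lemma mdegree_op_aut v :
  deg v ord_max = (\sum_(j < n) (v (inr (inl j)) + v (inr (inr j))))%N.
Proof.
rewrite ffunE big_sumType big1 ?add0n => [|x]; last first.
  have [k kx] := in_block_exists x; move: kx; rewrite -op_kind_der => /eqP kx; rewrite kx => /eqP E.
  by have := neq_lift ord_max k; rewrite E eqxx.
by rewrite big_sumType /= eqxx big_split.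
Qed.

(** Cancellation between an automorphism and its inverse can only lower the order. *)
Lemma pp_ord_le v k : (pp_ord mm (pp_of v) k <= deg v k)%N.
Proof.
rewrite /pp_ord; case: unliftP => [j ->|->].
  by rewrite mdegree_op_der; apply: leq_sum => nu _; rewrite ffunE.
rewrite mdegree_op_aut; apply: leq_sum => j _; rewrite ffunE. set a := v _; set b := v _. lia.
Qed.

(** The reduced word attains equality; with [pp_ord_le], a box of power products is the image of a
    box of words. *)
Lemma pp_of_surj (lam : power_product m n) :
  exists2 v, pp_of v = lam & forall k, deg v k = pp_ord mm lam k.
Proof.
pose v : {ffun operator m n -> nat} := [ffun x => match x with
  | inl i => lam.1 i
  | inr (inl j) => if lam.2 j is Posz l then l else 0
  | inr (inr j) => if lam.2 j is Negz l then l.+1 else 0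
  end]%N.
exists v.
  rewrite [RHS]surjective_pairing; congr pair; apply/ffunP => i; rewrite !ffunE //.
  by case: (lam.2 i) => l; rewrite ?subr0 ?NegzE ?sub0r.
move=> k; rewrite /pp_ord; case: unliftP => [j ->|->].
  by rewrite mdegree_op_der; apply: eq_bigr => nu _; rewrite ffunE.
rewrite mdegree_op_aut; apply: eq_bigr => j _; rewrite !ffunE.
by case: (lam.2 j) => l; rewrite ?addn0.
Qed.

End Orders.

(** * Counting monomials *)

Section Boxes.
Variable Z : finType.
Implicit Types (u v w : {ffun Z -> nat}).

(** The common bound [\sum_z u z] places all vectors below [u] in one finite function type. *)
Definition mbox u : seq {ffun Z -> nat} :=
  [seq [ffun z => f z : nat] |
     f : {ffun Z -> 'I_(\sum_z u z).+1} <- index_enum _ & [forall z, f z <= u z]%N].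

Lemma mem_mbox u v : (v \in mbox u) = mle v u.
Proof.
apply/mapP/mleP => [[f]|vu].
  by rewrite mem_filter => /andP[/forallP fu _] -> z; rewrite ffunE.
have lt z : (v z < (\sum_z u z).+1)%N.
  by rewrite ltnS (leq_trans (vu z)) // (bigD1 z) //= leq_addr.
exists [ffun z => Ordinal (lt z)]; last by apply/ffunP => z; rewrite !ffunE.
by rewrite mem_filter mem_index_enum andbT; apply/forallP => z; rewrite ffunE /= vu.
Qed.

Lemma mbox_uniq u : uniq (mbox u).
Proof.
rewrite map_inj_uniq ?filter_uniq ?index_enum_uniq // => f g /ffunP fg.
by apply/ffunP => z; apply: val_inj; have := fg z; rewrite !ffunE.
Qed.

(** Replaces the dependent index type of [binom_expansion] by a list of plain exponent vectors. *)
Lemma sum_mbox (R : nmodType) u (G : {ffun Z -> nat} -> R) :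
  \sum_(i : {dffun forall z, 'I_(u z).+1}) G [ffun z => i z : nat] =
  \sum_(v <- mbox u) G v.
Proof.
pose h (i : {dffun forall z, 'I_(u z).+1}) : {ffun Z -> nat} := [ffun z => i z : nat].
rewrite -[LHS](big_map h xpredT G); apply: perm_big.
apply: uniq_perm; last 1 first.
- move=> v; rewrite mem_mbox; apply/mapP/mleP => [[f _ ->] z|vu].
    by rewrite ffunE -ltnS.
  have lt z : (v z < (u z).+1)%N by rewrite ltnS.
  exists [ffun z => Ordinal (lt z)]; first exact: mem_index_enum.
  by apply/ffunP => z; rewrite !ffunE.
- rewrite map_inj_uniq ?index_enum_uniq // => f g /ffunP fg.
  by apply/ffunP => z; apply: val_inj; have := fg z; rewrite !ffunE.
- exact: mbox_uniq.
Qed.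

Lemma prod_sum_mbox (R : comPzSemiRingType) u (F : Z -> nat -> R) :
  \prod_z \sum_(i < (u z).+1) F z i = \sum_(v <- mbox u) \prod_z F z (v z).
Proof.
set B := (\sum_z u z)%N.
rewrite (eq_bigr (fun z => \sum_(i < B.+1 | (i <= u z)%N) F z i)) => [|z _]; last first.
  have uB : (u z < B.+1)%N by rewrite ltnS /B (bigD1 z) //= leq_addr.
  rewrite (big_ord_widen _ (F z) uB).
  by apply: eq_bigl => i; rewrite ltnS.
rewrite bigA_distr_big_dep big_map big_filter.
apply: eq_big => [f|f _]; last by apply: eq_bigr => z _; rewrite ffunE.
by apply/familyP/forallP.
Qed.

End Boxes.

(** * Dickson's lemma *)

Section Dickson.
Variable Z : finType.
Implicit Types (U : {ffun Z -> nat} -> Prop) (v w c : {ffun Z -> nat}).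

Definition upclosed U := forall v w, mle v w -> U v -> U w.

Lemma mle_refl v : mle v v. Proof. exact/mleP. Qed.
Lemma mle_trans v w c : mle v w -> mle w c -> mle v c.
Proof. by move=> /mleP vw /mleP wc; apply/mleP => z; apply: leq_trans (wc z). Qed.

Let upd x i v : {ffun Z -> nat} := [ffun z => if z == x then i else v z].

(** Induction on the variables: the slices at a fixed exponent of [x] grow with that exponent and
    depend on fewer variables. Their union is finitely generated, so they are constant from some
    exponent on. *)
Theorem Dickson U : upclosed U ->
  exists s : seq {ffun Z -> nat}, forall v, U v <-> has (mle^~ v) s.
Proof.
(* [xs] lists the variables on which [U] may depend. *)
suff main (xs : seq Z) : forall U, upclosed U ->
    (forall v w, (forall z, z \in xs -> v z = w z) -> U v -> U w) ->
    exists s, forall v, U v <-> has (mle^~ v) s.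
  move=> upU; apply: (main (enum Z)) => // v w vw; suff -> : v = w by [].
  by apply/ffunP => z; apply: vw; rewrite mem_enum.
elim: xs => [|x xs IH] {}U upU dep.
  have [U0|nU0] := pselect (U [ffun=> 0%N]).
    exists [:: [ffun=> 0%N]] => v; split=> // _; last by apply: dep U0.
    by rewrite /= orbF; apply/mleP => z; rewrite ffunE.
  by exists [::] => v; split=> // Uv; case: nU0; apply: dep Uv.
have upi i : upclosed (fun v => U (upd x i v)).
  move=> v w /mleP vw; apply: upU; apply/mleP => z; rewrite !ffunE.
  by case: ifP.
have depi i v w : (forall z, z \in xs -> v z = w z) -> U (upd x i v) -> U (upd x i w).
  move=> vw; apply: dep => z; rewrite inE !ffunE; case: eqP => //= _; exact: vw.
have /choice[s sP] : forall i, exists s : seq {ffun Z -> nat},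
    forall v, U (upd x i v) <-> has (mle^~ v) s.
  by move=> i; apply: IH => [|v w]; [apply: upi | apply: depi].
have [t tP] : exists t : seq {ffun Z -> nat},
    forall v, (exists i, U (upd x i v)) <-> has (mle^~ v) t.
  apply: IH => [v w vw [i Ui]|v w vw [i Ui]]; exists i.
    exact: upi Ui.
  exact: depi Ui.
(* Beyond [N] the slices [U (upd x i _)] no longer grow. *)
have [N NP] : exists N, forall c, c \in t -> U (upd x N c).
  have tU c : c \in t -> exists i, U (upd x i c).
    by move=> ct; apply/tP/hasP; exists c => //; apply: mle_refl.
  elim: (t) tU => [|c t' IHt] tU; first by exists 0%N.
  have [|N NP] := IHt; first by move=> c' c't; apply: tU; rewrite inE c't orbT.
  have [i Ui] := tU c (mem_head _ _); exists (maxn i N) => c'.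
  have mono j k w : (j <= k)%N -> U (upd x j w) -> U (upd x k w).
    by move=> jk; apply: upU; apply/mleP => z; rewrite !ffunE; case: ifP.
  rewrite inE => /predU1P[->|/NP]; first exact: mono (leq_maxl _ _) Ui.
  exact/mono/leq_maxr.
(* The generators of the slices at exponents 0 to [N], each given its own exponent of [x]; larger
   exponents reduce to [N]. *)
exists (flatten [seq [seq upd x i c | c <- s i] | i <- iota 0 N.+1]) => v; split.
- move=> Uv; have vE : upd x (v x) v = v.
    by apply/ffunP => z; rewrite ffunE; case: eqP => [->|].
  have : U (upd x (minn (v x) N) v).
    case: (leqP (v x) N) => [_|Nv]; first by rewrite vE.
    have /tP/hasP[c ct cv] : exists i, U (upd x i v) by exists (v x); rewrite vE.
    by apply: upi cv _; apply: NP.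
  move/sP => /hasP[c cs cv]; apply/hasP; exists (upd x (minn (v x) N) c).
    apply/flatten_mapP; exists (minn (v x) N); last by apply: map_f.
    by rewrite mem_iota ltnS geq_minr.
  apply/mleP => z; rewrite ffunE; case: eqP => [->|_]; first exact: geq_minl.
  exact: (mleP _ _ cv).
- move=> /hasP[c' /flatten_mapP[i _ /mapP[c cs ->]]] cv; apply: (upU _ _ cv).
  by apply/sP/hasP; exists c => //; apply: mle_refl.
Qed.

End Dickson.

(** * Monomials of a given multidegree *)

Section Counting.
Variables (Z : finType) (q : nat) (kd : Z -> 'I_q).
Implicit Types (v w b c : {ffun Z -> nat}) (r : {ffun 'I_q -> nat}).
Local Notation deg := (mdegree kd).

Definition mons r : seq {ffun Z -> nat} :=
  [seq v <- mbox [ffun z => r (kd z)] | deg v == r].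

Lemma mem_mons r v : (v \in mons r) = (deg v == r).
Proof.
rewrite mem_filter mem_mbox andb_idr // => /eqP <-.
by apply/mleP => z; rewrite ffunE leq_mdegree.
Qed.

Lemma mons_uniq r : uniq (mons r).
Proof. exact/filter_uniq/mbox_uniq. Qed.

(** The number of monomials of degree [i] in [k] variables; without variables there is only the one
    of degree 0. *)
Definition multichoose k i : nat := if k is k'.+1 then 'C(i + k', k') else (i == 0)%N.

Lemma multichooseS k i :
  multichoose k.+1 i = (multichoose k i + (if i is i'.+1 then multichoose k.+1 i' else 0))%N.
Proof.
case: k => [|k] /=; first by case: i => [|i]; rewrite !bin0.
case: i => [|i]; first by rewrite !add0n !binn.
by rewrite !addSn addnS binS addnC.
Qed.

Local Arguments multichoose : simpl never.

Let supp (xs : seq Z) v := [forall z, (z \notin xs) ==> (v z == 0%N)].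

Let suppP xs v : reflect (forall z, z \notin xs -> v z = 0%N) (supp xs v).
Proof.
apply: (iffP forallP) => vs z; first by move=> zxs; have := vs z; rewrite zxs => /eqP.
by apply/implyP => /vs ->.
Qed.

Let mem_mons_supp xs r v :
  (v \in [seq v <- mons r | supp xs v]) = supp xs v && (deg v == r).
Proof. by rewrite mem_filter mem_mons. Qed.

(** A monomial either avoids [x] or is [x] times a monomial whose multidegree is one less in the
    component of [x]. *)
Lemma size_mons_supp_cons x (xs : seq Z) r : x \notin xs ->
  size [seq v <- mons r | supp (x :: xs) v] =
  (size [seq v <- mons r | supp xs v] +
   (if r (kd x) is _.+1 then
      size [seq v <- mons [ffun k => r k - (k == kd x)] | supp (x :: xs) v]
    else 0))%N.
Proof.
move=> xxs.
pose ys := if r (kd x) is _.+1 then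
  [seq v <- mons [ffun k => r k - (k == kd x)]%N | supp (x :: xs) v] else [::].
rewrite (_ : (if _ is _.+1 then _ else _) = size [seq mincr x v | v <- ys]); last first.
  by rewrite size_map /ys; case: (r (kd x)).
have mincr_inj : injective (mincr x).
  by move=> v w /ffunP vw; apply/ffunP => z; have := vw z; rewrite !ffunE => /addIn.
rewrite -size_cat; apply/perm_size/uniq_perm.
- exact/filter_uniq/mons_uniq.
- rewrite cat_uniq filter_uniq ?mons_uniq //= map_inj_uniq //.
  apply/andP; split; last by rewrite /ys; case: (r (kd x)) => // _; apply/filter_uniq/mons_uniq.
  apply/hasPn => _ /mapP[v _ ->]; rewrite mem_mons_supp; apply/negP => /andP[/suppP/(_ x xxs)].
  by rewrite ffunE eqxx addn1.
move=> v; rewrite mem_cat !mem_mons_supp; apply/andP/orP.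
- move=> [/suppP vs /eqP dv]; have [vx|vx] := posnP (v x); [left|right].
    rewrite dv eqxx andbT; apply/suppP => z zxs; case: (eqVneq z x) => [->//|zx].
    by apply: vs; rewrite inE negb_or zx.
  pose w : {ffun Z -> nat} := [ffun z => v z - (z == x)]%N.
  have vE : v = mincr x w.
    by apply/ffunP => z; rewrite !ffunE; case: eqP => [->|_]; rewrite ?subn0 ?addn0 ?subnK.
  have rE k : r k = (deg w k + (k == kd x))%N by rewrite -dv vE mdegree_mincr.
  apply/mapP; exists w => //.
  rewrite /ys [r (kd x)]rE eqxx addn1 mem_mons_supp; apply/andP; split.
    by apply/suppP => z zxs; rewrite ffunE vs.
  by apply/eqP/ffunP => k; rewrite [RHS]ffunE rE addnK.
- case=> [/andP[/suppP vs ->]|/mapP[w]].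
    split=> //; apply/suppP => z; rewrite inE negb_or => /andP[_]; exact: vs.
  rewrite /ys; case E : (r (kd x)) => [|i] //; rewrite mem_mons_supp.
  move=> /andP[/suppP ws /eqP dw] ->; split.
    apply/suppP => z zxs; rewrite ffunE ws //.
    by move: zxs; rewrite inE negb_or => /andP[/negPf->].
  apply/eqP/ffunP => k; rewrite mdegree_mincr dw ffunE subnK //.
  by case: eqP => [->|//]; rewrite E.
Qed.

Lemma size_mons_supp (xs : seq Z) r : uniq xs ->
  size [seq v <- mons r | supp xs v] =
  (\prod_k multichoose (count (fun x => kd x == k) xs) (r k))%N.
Proof.
elim: xs => [|x xs IH] in r *.
  move=> _; rewrite (eq_filter (a2 := pred1 [ffun=> 0%N])) => [|v]; last first.
    apply/suppP/eqP => [v0|-> z _]; last by rewrite ffunE.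
    by apply/ffunP => z; rewrite ffunE; apply: v0.
  rewrite size_filter count_uniq_mem ?mons_uniq // mem_mons.
  have -> : deg [ffun=> 0%N] = [ffun=> 0%N].
    by apply/ffunP => k; rewrite !ffunE big1 // => z _; rewrite ffunE.
  rewrite eq_sym; case: eqP => [->|r0].
    by rewrite big1 // => k _; rewrite ffunE.
  have [k rk] : exists k, r k != 0%N.
    apply/existsP; rewrite -negb_forall; apply/negP => /forallP r00.
    by case: r0; apply/ffunP => k; rewrite ffunE; apply/eqP.
  by rewrite (bigD1 k) //= /multichoose (negPf rk).
(* Inner induction on the degree in the component of [x], which drops by one when [x] is divided
   out. *)
move=> /= /andP[xxs uxs]; move: {2}(r (kd x)) (erefl (r (kd x))) => i.
elim: i r => [|i IHi] r ri; rewrite size_mons_supp_cons // IH // ri.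
  rewrite addn0; apply: eq_bigr => k _; case: eqP => [<-|_]; last by rewrite add0n.
  by rewrite ri add1n multichooseS addn0.
rewrite IHi ?ffunE ?ri ?eqxx ?subn1 //.
rewrite [X in (X + _)%N](bigD1 (kd x)) //= [X in (_ + X)%N](bigD1 (kd x)) //=.
rewrite [RHS](bigD1 (kd x)) //= !eqxx ffunE ri eqxx add1n subn1 /=.
rewrite [in RHS]multichooseS mulnDl; congr (_ + _)%N.
  congr (_ * _)%N; apply: eq_bigr => k nk; rewrite [kd x == k]eq_sym (negPf nk).
  by rewrite add0n.
by congr (_ * _)%N; apply: eq_bigr => k nk; rewrite ffunE (negPf nk) subn0.
Qed.

Lemma size_mons r :
  size (mons r) = (\prod_k multichoose #|[pred x | kd x == k]| (r k))%N.
Proof.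
rewrite -(filter_predT (mons r)) -(eq_filter (a1 := supp (enum Z))) => [|v].
  rewrite size_mons_supp ?enum_uniq //; apply: eq_bigr => k _.
  by rewrite -size_filter cardE enumT.
by apply/suppP => z; rewrite mem_enum.
Qed.

End Counting.

Section ShiftedBinomial.

(* [binomial (t - c + u) u] expanded along the [binomial (t + i) i]. *)
Fixpoint shift_coef (c u i : nat) : int :=
  if c is c'.+1 then
    shift_coef c' u i - (if u is u'.+1 then shift_coef c' u' i else 0)
  else (i == u)%:R.

Lemma shift_coef_gt c u i : (u < i)%N -> shift_coef c u i = 0.
Proof.
elim: c u => [|c IH] u ui /=; first by rewrite gtn_eqF.
by rewrite IH //; case: u ui => [|u] ui; rewrite ?subr0 // IH ?subr0 // ltnW.
Qed.

Lemma shift_coef_diag c u : shift_coef c u u = 1.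
Proof.
elim: c u => [|c IH] u /=; first by rewrite eqxx.
by rewrite IH; case: u => [|u]; rewrite ?subr0 // shift_coef_gt ?subr0.
Qed.

(** Pascal's rule [C(r-c-1+u, u) = C(r-c+u, u) - C(r-c+u-1, u-1)] is the recursion of
    [shift_coef]. *)
Lemma sum_shift_coef c u r : (c <= r)%N ->
  \sum_(i < u.+1) shift_coef c u i * 'C(r + i, i)%:Z = 'C(r - c + u, u)%:Z.
Proof.
elim: c u => [|c IH] u cr.
  rewrite subn0 (bigD1 ord_max) //= eqxx mul1r big1 ?addr0 // => i.
  by rewrite -val_eqE /= => /negPf ->; rewrite mul0r.
have cr' := ltnW cr.
rewrite /= (eq_bigr (fun i : 'I_u.+1 => shift_coef c u i * 'C(r + i, i)%:Z -
   (if u is u'.+1 then shift_coef c u' i else 0) * 'C(r + i, i)%:Z)) => [|i _].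
  rewrite sumrB IH //; case: u => [|u].
    by rewrite !bin0 big1 ?subr0 // => i _; rewrite mul0r.
  rewrite big_ord_recr /= shift_coef_gt // mul0r addr0 IH //.
  rewrite -[(r - c)%N](subnSK cr) subnS !addnS /= addSn binS PoszD; ring.
by rewrite mulrBl.
Qed.

End ShiftedBinomial.

(** * Counts that are eventually integer combinations of binomials *)

Section EventuallyPolynomial.
Variables (q : nat) (u : {ffun 'I_q -> nat}).
Implicit Types (a : {ffun 'I_q -> nat} -> int) (r : {ffun 'I_q -> nat}).

Definition binom_value a r : int :=
  \sum_(v <- mbox u) a v * \prod_k 'C(r k + v k, v k)%:Z.

Definition eventually_poly (f : {ffun 'I_q -> nat} -> int) a : Prop :=
  exists r0, forall r, mle r0 r -> f r = binom_value a r.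

Lemma eventually_polyD f g a b :
  eventually_poly f a -> eventually_poly g b ->
  eventually_poly (fun r => f r + g r) (fun v => a v + b v).
Proof.
move=> [r0 fa] [r1 gb]; exists (madd r0 r1) => r r01.
rewrite fa ?gb; first by rewrite -big_split; apply: eq_bigr => v _; rewrite mulrDl.
  by apply: mle_trans r01; apply/mleP => k; rewrite ffunE leq_addl.
by apply: mle_trans r01; apply/mleP => k; rewrite ffunE leq_addr.
Qed.

Lemma eventually_polyB f g a b :
  eventually_poly f a -> eventually_poly g b ->
  eventually_poly (fun r => f r - g r) (fun v => a v - b v).
Proof.
move=> fa [r1 gb]; apply: (eventually_polyD fa); exists r1 => r /gb ->.
by rewrite -sumrN; apply: eq_bigr => v _; rewrite mulNr.
Qed.

Lemma eventually_poly_sum (I : Type) (s : seq I) (f : I -> {ffun 'I_q -> nat} -> int)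
    (a : I -> {ffun 'I_q -> nat} -> int) :
  (forall i, eventually_poly (f i) (a i)) ->
  eventually_poly (fun r => \sum_(i <- s) f i r) (fun v => \sum_(i <- s) a i v).
Proof.
move=> fa; elim: s => [|i s IH].
  exists [ffun=> 0%N] => r _; rewrite big_nil /binom_value big1 // => v _.
  by rewrite big_nil mul0r.
have [r0 H] := eventually_polyD (fa i) IH; exists r0 => r /H.
rewrite big_cons => ->; apply: eq_bigr => v _; by rewrite big_cons.
Qed.

Variables (Z : finType) (kd : Z -> 'I_q).
Hypothesis card_kd : forall k, #|[pred x | kd x == k]| = (u k).+1.
Local Notation deg := (mdegree kd).

(** Dividing by [b] leaves the monomials of multidegree [r - deg b]. As component [k] has [u_k + 1]
    variables, their number is the product of the [C(r_k - deg_k b + u_k, u_k)], and each shifted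
    binomial has leading coefficient 1 in its expansion. *)
Lemma eventually_poly_above b : exists a, a u = 1 /\
  eventually_poly (fun r => (size [seq v <- mons kd r | mle b v])%:Z) a.
Proof.
exists (fun v => \prod_k shift_coef (deg b k) (u k) (v k)); split.
  by rewrite big1 // => k _; apply: shift_coef_diag.
exists (deg b) => r /mleP br.
have -> : size [seq v <- mons kd r | mle b v] =
    size (mons kd [ffun k => r k - deg b k]%N).
  rewrite -[RHS](size_map (madd b)); apply/perm_size/uniq_perm.
  - exact/filter_uniq/mons_uniq.
  - rewrite map_inj_uniq ?mons_uniq // => v w /ffunP vw.
    by apply/ffunP => z; have := vw z; rewrite !ffunE => /addnI.
  move=> v; rewrite mem_filter mem_mons; apply/andP/mapP.
  + move=> [/mleP bv /eqP dv]; pose w : {ffun Z -> nat} := [ffun z => v z - b z]%N.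
    have vE : v = madd b w by apply/ffunP => z; rewrite !ffunE subnKC.
    exists w; rewrite // mem_mons; apply/eqP/ffunP => k.
    by rewrite [RHS]ffunE -dv [in RHS]vE mdegreeD addKn.
  + move=> [w]; rewrite mem_mons => /eqP dw ->; split.
      by apply/mleP => z; rewrite ffunE leq_addr.
    by apply/eqP/ffunP => k; rewrite mdegreeD dw [X in (_ + X)%N]ffunE subnKC.
rewrite size_mons /binom_value.
transitivity (\sum_(v <- mbox u) \prod_k
    (shift_coef (deg b k) (u k) (v k) * 'C(r k + v k, v k)%:Z)); last first.
  by apply: eq_bigr => v _; rewrite big_split.
rewrite -(prod_sum_mbox u (fun k i => shift_coef (deg b k) (u k) i * 'C(r k + i, i)%:Z)).
rewrite (big_morph Posz PoszM (erefl _)); apply: eq_bigr => k _.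
by rewrite sum_shift_coef // card_kd /= ffunE.
Qed.

(** Inclusion-exclusion one generator at a time: avoiding [c :: s] above [b] is avoiding [s] above
    [b], minus avoiding [s] above the least common multiple of [b] and [c]. The two top coefficients
    are equal and cancel. *)
Lemma eventually_poly_avoid_seq (s : seq {ffun Z -> nat}) b :
  exists a, a u = (nilp s)%:R /\
  eventually_poly (fun r => (size [seq v <- mons kd r | mle b v && ~~ has (mle^~ v) s])%:Z) a.
Proof.
elim: s b => [|c s IH] b.
  have [a [au [r0 H]]] := eventually_poly_above b; exists a; split=> //.
  exists r0 => r /H <-; congr (size _)%:Z; apply: eq_filter => v.
  by rewrite andbT.
have [a [au H]] := IH b; have [a' [au' H']] := IH [ffun z => maxn (b z) (c z)].
exists (fun v => a v - a' v); split; first by rewrite au au' subrr.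
have [r0 {}H] := eventually_polyB H H'; exists r0 => r /H <-.
apply/eqP; rewrite eq_sym subr_eq -PoszD eqz_nat !size_filter -!sum1_count.
rewrite (bigID (fun v => mle c v)) /= addnC; apply/eqP; congr (_ + _)%N.
  by apply: eq_bigl => v; rewrite negb_or andbAC andbA.
apply: eq_bigl => v; rewrite andbAC; congr (_ && _).
apply/andP/mleP => [[/mleP bv /mleP cv] z|bcv]; first by rewrite ffunE geq_max bv cv.
by split; apply/mleP => z; have := bcv z; rewrite ffunE geq_max => /andP[].
Qed.

(** By Dickson's lemma [U] has finitely many generators; top coefficient 1 means that there are
    none. *)
Lemma eventually_poly_avoid (U : {ffun Z -> nat} -> Prop) b : upclosed U ->
  exists a, [/\ a u = 1 \/ a u = 0, a u = 1 -> forall v, ~ U v &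
  eventually_poly
    (fun r => (size [seq v <- mons kd r | mle b v && ~~ `[< U v >]])%:Z) a].
Proof.
move=> /Dickson[s Us]; have [a [au H]] := eventually_poly_avoid_seq s b.
exists a; rewrite au; split; first by case: nilp; [left | right].
  by case: s Us {au H} => //= Us _ v /Us.
have [r0 {}H] := H; exists r0 => r /H <-; congr (size _)%:Z; apply: eq_filter => v.
by congr (_ && ~~ _); apply/asboolP/idP => /Us.
Qed.

End EventuallyPolynomial.

(** * Numerical polynomials *)

Section BinomialExpansion.
Variable N : nat.
Implicit Types (f v u : {ffun 'I_N -> nat}) (a : {ffun 'I_N -> nat} -> int).

Lemma meval_mpoly_binom (k : 'I_N) i (r : 'I_N -> nat) :
  (mpoly_binom ('X_k + (i : nat)%:R) i).@[fun k => (r k)%:R] = 'C(r k + i, i)%:R :> rat.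
Proof.
rewrite /mpoly_binom mevalZ rmorph_prod /=.
rewrite (eq_bigr (fun j : 'I_i => (r k + i - j)%:R)) => [|j _]; last first.
  rewrite !mevalB mevalD mevalXU -!mpolyC_nat !mevalC natrB ?natrD //.
  by rewrite (leq_trans (ltnW (ltn_ord j))) // leq_addl.
rewrite -natr_prod -ffact_prod -bin_ffact natrM mulrCA mulVf ?mulr1 //.
by rewrite pnatr_eq0 -lt0n fact_gt0.
Qed.

Lemma meval_binom_expansion u a (r : 'I_N -> nat) :
  (binom_expansion u a).@[fun k => (r k)%:R] = (binom_value u a [ffun k => r k])%:~R :> rat.
Proof.
rewrite /binom_expansion /binom_value -(sum_mbox u (fun v => a v * _)).
rewrite raddf_sum [RHS]raddf_sum; apply: eq_bigr => i _ /=.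
rewrite mevalZ intrM rmorph_prod /= [X in _ = _ * X]rmorph_prod /=; congr (_ * _).
by apply: eq_bigr => k _; rewrite meval_mpoly_binom !ffunE.
Qed.

(** The polynomial [(X + 1) ... (X + i) / i!], written through its roots. *)
Definition binom_poly i : {poly rat} :=
  (i`!%:R)^-1 *: \prod_(j < i) ('X - ((j : nat)%:R - i%:R)%:P).

Lemma size_binom_poly i : size (binom_poly i) = i.+1.
Proof.
rewrite size_scale ?invr_eq0 ?pnatr_eq0 -?lt0n ?fact_gt0 //.
by rewrite size_prod_XsubC /index_enum -enumT size_enum_ord.
Qed.

Lemma coef_binom_poly i : (binom_poly i)`_i = (i`!%:R)^-1.
Proof.
rewrite coefZ (_ : _`_i = 1) ?mulr1 //.
have /monicP := monic_prod_XsubC (index_enum 'I_i) xpredT (fun j : 'I_i => (j : nat)%:R -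
  i%:R : rat).
by rewrite lead_coefE size_prod_XsubC /index_enum -enumT size_enum_ord.
Qed.

Lemma mpoly_binomE (k : 'I_N) i :
  mpoly_binom ('X_k + (i : nat)%:R) i = \sum_(j < i.+1) (binom_poly i)`_j *: 'X_k ^+ j.
Proof.
transitivity ((map_poly (@mpolyC N rat) (binom_poly i)).['X_k]).
  rewrite /binom_poly map_polyZ hornerZ mul_mpolyC; congr (_ *: _).
  rewrite rmorph_prod horner_prod; apply: eq_bigr => j _.
  by rewrite /= map_polyXsubC hornerXsubC /= mpolyCB !rmorph_nat opprB addrA addrAC.
rewrite (@horner_coef_wide _ i.+1) ?size_map_poly ?size_binom_poly //.
by apply: eq_bigr => j _; rewrite coef_map /= mul_mpolyC.
Qed.

Definition binom_coef f v : rat := \prod_k (binom_poly (f k))`_(v k).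

Definition mnm_of v : 'X_{1..N} := [multinom v k | k < N].

Lemma mnm_of_inj : injective mnm_of.
Proof. by move=> v w /mnmP vw; apply/ffunP => k; have := vw k; rewrite !mnmE. Qed.

Lemma binom_expansionE u a :
  binom_expansion u a =
  \sum_(f <- mbox u) \sum_(v <- mbox f) ((a f)%:~R * binom_coef f v) *: 'X_[mnm_of v].
Proof.
rewrite -(sum_mbox u (fun f => \sum_(v <- mbox f) _)); apply: eq_bigr => i _.
set f := [ffun k => i k : nat].
rewrite (eq_bigr (fun k => \sum_(j < (f k).+1) (binom_poly (f k))`_j *: 'X_k ^+ j)).
  rewrite (prod_sum_mbox f (fun k j => (binom_poly (f k))`_j *: 'X_k ^+ j)) scaler_sumr.
  apply: eq_bigr => v _; rewrite -scalerA scaler_prod; congr (_ *: (_ *: _)).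
  rewrite mpolyXE_id; apply: eq_bigr => k _; by rewrite mnmE.
by move=> k _; rewrite /f ffunE mpoly_binomE.
Qed.

(** The term with index [f] only produces monomials that divide the one with exponent [f]. *)
Lemma msupp_binom_expansion u a (mon : 'X_{1..N}) :
  mon \in msupp (binom_expansion u a) ->
  exists2 f, expansion_support u a f & forall k, (mon k <= f k)%N.
Proof.
rewrite mcoeff_msupp; apply: contra_neqP => nf.
rewrite binom_expansionE raddf_sum big_seq big1 //= => f; rewrite mem_mbox => /mleP fu.
rewrite raddf_sum big_seq big1 //= => v; rewrite mem_mbox => /mleP vf.
rewrite mcoeffZ mcoeffX; case: eqP => [E|]; rewrite ?mulr0 // mulr1.
have [->|/eqP af] := eqVneq (a f) 0; first by rewrite mul0r.
by case: nf; exists f => // k; rewrite -E mnmE.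
Qed.

(** Only terms with index above [e] reach this monomial, so the term at [e] remains, with the
    leading coefficients [1 / e_k!] of its binomials. *)
Lemma mcoeff_binom_expansion u a e : mle e u ->
  (forall f, expansion_support u a f -> mle e f -> f = e) ->
  (binom_expansion u a)@_(mnm_of e) = (a e)%:~R / (\prod_k ((e k)`!)%:R).
Proof.
move=> eu emax; rewrite binom_expansionE raddf_sum /=.
rewrite (bigD1_seq e) ?mem_mbox ?mbox_uniq //= raddf_sum /=.
rewrite (bigD1_seq e) ?mem_mbox ?mbox_uniq ?mle_refl //= mcoeffZ mcoeffX eqxx mulr1.
rewrite [X in _ + X + _]big1 ?addr0; last first.
  by move=> v ve; rewrite mcoeffZ mcoeffX (inj_eq mnm_of_inj) (negPf ve) mulr0.
rewrite [X in _ + X]big_seq_cond [X in _ + X]big1 ?addr0.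
  by congr (_ * _); rewrite -prodfV; apply: eq_bigr => k _; rewrite coef_binom_poly.
move=> f; rewrite mem_mbox => /andP[fu fe]; rewrite raddf_sum big_seq big1 //= => v.
rewrite mem_mbox => vf; rewrite mcoeffZ mcoeffX (inj_eq mnm_of_inj).
case: eqP => [E|]; last by rewrite mulr0.
have [->|/eqP af] := eqVneq (a f) 0; first by rewrite mul0r mul0r.
case/eqP: fe; apply: emax; last by rewrite -E.
by split=> //; apply/mleP.
Qed.

End BinomialExpansion.

(** * Inequalities between polynomials and their leading forms *)

Section Positivity.

Lemma coefM_top (R : nzRingType) (p p' : {poly R}) d d' :
  (size p <= d.+1)%N -> (size p' <= d'.+1)%N ->
  (size (p * p')%R <= (d + d').+1)%N /\ (p * p')`_(d + d') = p`_d * p'`_d'.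
Proof.
move=> pd pd'; split.
  by move: (size (p * p')) (size p) (size p') (size_polyMleq p p') pd pd'; lia.
rewrite coefM; have dd : (d < (d + d').+1)%N by rewrite ltnS leq_addr.
rewrite (bigD1 (Ordinal dd)) //= addKn big1 ?addr0 // => i id.
have [di|di] := ltnP d i; first by rewrite nth_default ?mul0r // (leq_trans pd).
rewrite [X in _ * X]nth_default ?mulr0 //; apply: leq_trans pd' _.
by move: id di; rewrite -val_eqE /= => /eqP; lia.
Qed.

Lemma top_coef_ge0 (p : {poly rat}) e x0 : (size p <= e.+1)%N ->
  (forall x : nat, (x0 <= x)%N -> 0 <= p.[x%:R]) -> 0 <= p`_e.
Proof.
move=> pe pos; rewrite leNgt; apply/negP => pneg.
pose C := \sum_(i < e) `|p`_i|.
(* Past [C] divided by the absolute value of the top coefficient, the negative top term outweighs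
   the others; [x >= 1] bounds every lower power by the highest of them. *)
pose x := (maxn x0 (maxn 1 (Num.bound (C / - p`_e)))).
have x1 : 1 <= x%:R :> rat by rewrite ler1n /x !leq_max leqnn orbT.
have Cx : C < - p`_e * x%:R.
  rewrite mulrC -ltr_pdivrMr ?oppr_gt0 //.
  apply: lt_le_trans (archi_boundP _) _.
    by rewrite divr_ge0 ?sumr_ge0 // oppr_ge0 ltW.
  by rewrite ler_nat /x !leq_max leqnn !orbT.
have := pos x; rewrite /x leq_maxl -/x => /(_ isT).
rewrite (horner_coef_wide _ pe) big_ord_recr /= => px.
move: px; apply/negP; rewrite -ltNge; case: e pe pneg @C @x x1 Cx => [|e] pe pneg C x x1 Cx.
  by rewrite big_ord0 add0r mulr1.
apply: (@le_lt_trans _ _ (x%:R ^+ e * (C - - p`_e.+1 * x%:R))); last first.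
  by rewrite pmulr_rlt0 ?subr_lt0 // exprn_gt0 // (lt_le_trans ltr01).
rewrite mulrBr mulNr mulrN opprK mulrCA exprS [x%:R ^+ e * _ in leRHS]mulrC; apply: lerD.
  rewrite /C mulr_suml; apply: ler_sum => i _.
  apply: le_trans (ler_norm _) _; rewrite normrM ler_wpM2l // ger0_norm ?exprn_ge0 //.
  by apply: ler_weXn2l => //; rewrite -ltnS.
by rewrite [x%:R * _]mulrC.
Qed.

End Positivity.

(** Comparison up to a constant translation, which is what a change of generators provides. *)
Definition shift_le N (Phi Psi : {mpoly rat[N]}) : Prop :=
  exists r0 c : nat, forall r : 'I_N -> nat, (forall k, r0 <= r k)%N ->
    Phi.@[fun k => (r k)%:R] <= Psi.@[fun k => (r k + c)%:R].

Section WeightedForms.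
Variables (N : nat) (w : 'I_N -> nat).
Hypothesis w_gt0 : forall k, (0 < w k)%N.
Implicit Types (Phi Psi : {mpoly rat[N]}) (v : 'I_N -> nat).

Definition wdeg (f : 'I_N -> nat) : nat := (\sum_k w k * f k)%N.

Definition weighted_form e Phi : {mpoly rat[N]} :=
  \sum_(m <- msupp Phi | wdeg m == e) Phi@_m *: 'X_[m].

Lemma mcoeff_weighted_form e Phi (m : 'X_{1..N}) :
  (weighted_form e Phi)@_m = if wdeg m == e then Phi@_m else 0.
Proof.
rewrite raddf_sum /= big_mkcond /=.
have F (m' : 'X_{1..N}) : (if wdeg m' == e then (Phi@_m' *: 'X_[m'])@_m else 0) =
   (if m' == m then (if wdeg m == e then Phi@_m else 0) else 0).
  rewrite mcoeffZ mcoeffX; case: (eqVneq m' m) => [->|_]; first by rewrite mulr1.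
  by rewrite mulr0 if_same.
under eq_bigr do rewrite F.
have [ms|ms] := boolP (m \in msupp Phi).
  rewrite (bigD1_seq m) ?msupp_uniq //= eqxx big1 ?addr0 // => m' /negPf ->.
  by [].
rewrite big_seq big1 ?(memN_msupp_eq0 ms) ?if_same // => m' m's.
by case: eqP => // E; rewrite -E m's in ms.
Qed.

Let curve v c Phi : {poly rat} :=
  \sum_(m <- msupp Phi) Phi@_m *: \prod_k ((v k)%:R *: 'X^(w k) + (c%:R)%:P) ^+ m k.

Let horner_curve v c Phi (x : nat) :
  (curve v c Phi).[x%:R] = Phi.@[fun k => (v k * x ^ w k + c)%:R].
Proof.
rewrite mevalE horner_sum; apply: eq_bigr => m _; rewrite hornerZ horner_prod.
congr (_ * _); apply: eq_bigr => k _.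
by rewrite horner_exp hornerD hornerZ hornerXn hornerC natrD natrM natrX.
Qed.

Let top (p : {poly rat}) d l := (size p <= d.+1)%N /\ p`_d = l.

Let topM p p' d d' l l' : top p d l -> top p' d' l' -> top (p * p') (d + d')%N (l * l').
Proof. by move=> [pd <-] [pd' <-]; apply: coefM_top. Qed.

Let topX p d l k : top p d l -> top (p ^+ k) (d * k)%N (l ^+ k).
Proof.
move=> pd; elim: k => [|k IH].
  by rewrite muln0 !expr0; split; rewrite ?size_poly1 // coef1.
by rewrite mulnS !exprS; apply: topM.
Qed.

Let top_monomial v c (m : 'X_{1..N}) :
  top (\prod_k ((v k)%:R *: 'X^(w k) + (c%:R)%:P) ^+ m k) (wdeg m) (\prod_k (v k)%:R ^+ m k).
Proof.
rewrite /wdeg; elim/big_ind3: _ => [|????????|k _].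
- by split; rewrite ?size_poly1 // coef1.
- exact: topM.
apply: topX; split.
  apply: leq_trans (size_polyD _ _) _; rewrite geq_max.
  rewrite (leq_trans (size_scale_leq _ _)) ?size_polyXn //.
  by rewrite (leq_trans (size_polyC_leq1 _)).
by rewrite coefD coefZ coefXn eqxx mulr1 coefC gtn_eqF ?addr0.
Qed.

Let curve_top e v c Phi : (forall m : 'X_{1..N}, m \in msupp Phi -> (wdeg m <= e)%N) ->
  top (curve v c Phi) e (weighted_form e Phi).@[fun k => (v k)%:R].
Proof.
move=> Phie; split.
  rewrite /curve; apply: (leq_trans (size_sum _ _ _)); apply/bigmax_leqP_seq => m ms _.
  apply: leq_trans (size_scale_leq _ _) _; apply: (leq_trans (top_monomial v c m).1).
  by rewrite ltnS Phie.
rewrite coef_sum /weighted_form raddf_sum /= [RHS]big_mkcond big_seq [RHS]big_seq.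
apply: eq_bigr => m ms; rewrite coefZ mevalZ mevalX.
have [tm1 tm2] := top_monomial v c m.
have [<-|me] := eqVneq; first by rewrite tm2.
by rewrite nth_default ?mulr0 // (leq_trans tm1) // ltn_neqAle me Phie.
Qed.

(** Along [r_k = v_k x^(w_k)] both sides are polynomials in [x] whose coefficient at [x^e] is the
    form at [v]; the translation by [c] affects only lower powers because every weight is
    positive. *)
Lemma weighted_form_le Phi Psi e :
    shift_le Phi Psi ->
    (forall m : 'X_{1..N}, m \in msupp Phi -> (wdeg m <= e)%N) ->
    (forall m : 'X_{1..N}, m \in msupp Psi -> (wdeg m <= e)%N) ->
  forall v, (forall k, 0 < v k)%N ->
  (weighted_form e Phi).@[fun k => (v k)%:R] <= (weighted_form e Psi).@[fun k => (v k)%:R].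
Proof.
move=> [r0 [c le]] Phie Psie v v0.
have [Phis <-] := curve_top v 0 Phie; have [Psis <-] := curve_top v c Psie.
rewrite -subr_ge0 -coefB; apply: (@top_coef_ge0 _ _ (maxn 1 r0)).
  by rewrite (leq_trans (size_polyD _ _)) // size_polyN geq_max Phis Psis.
move=> x; rewrite geq_max => /andP[x0 rx]; rewrite hornerD hornerN subr_ge0 !horner_curve.
have rE : forall k, (r0 <= v k * x ^ w k)%N.
  move=> k; apply: (leq_trans rx); apply: leq_trans (_ : x ^ w k <= _)%N; last exact: leq_pmull.
  by rewrite -[X in (X <= _)%N]expn1 leq_pexp2l.
have := le _ rE; congr (_ <= _); apply: meval_eq => k; by rewrite addn0.
Qed.

Lemma mpoly_eq0_nat n (p : {mpoly rat[n]}) :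
  (forall v : 'I_n -> nat, (forall k, 0 < v k)%N -> p.@[fun k => (v k)%:R] = 0) -> p = 0.
Proof.
elim: n => [|n IH] in p * => p0.
  by have := p0 (fun=> 1%N) (fun=> isT); rewrite [p]nvar0_mpolyC mevalC => ->; rewrite mpolyC0.
apply: muni_eq0; apply/polyP => i; rewrite coef0; apply: IH => v v0.
pose x := fun k : 'I_n => (v k)%:R : rat.
suff P0 : map_poly (meval x) (muni p) = 0 by rewrite -[LHS](coef_map (meval x)) P0 coef0.
set P := map_poly _ _; apply: contraTeq isT => P0.
(* The polynomial in the last variable vanishes at 1, ..., [size P]: more roots than its degree. *)
have /(max_poly_roots P0) : all (root P) [seq (k.+1)%:R | k <- iota 0 (size P)].
  apply/allP => _ /mapP[k _ ->].
  pose v' (j : 'I_n.+1) := if unlift ord_max j is Some j' then v j' else k.+1.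
  have v'0 j : (0 < v' j)%N by rewrite /v'; case: unliftP.
  rewrite rootE -[0](p0 v' v'0) horner_muni /v' unlift_none; apply/eqP.
  congr (_.[_]); apply: eq_map_poly => r; apply: meval_eq => j /=.
  by rewrite widen_ord_lift liftK.
suff u : uniq [seq (k.+1)%:R : rat | k <- iota 0 (size P)].
  by move/(_ u); rewrite size_map size_iota ltnn.
rewrite map_inj_uniq ?iota_uniq // => a b /eqP.
by rewrite eqr_nat => /eqP[].
Qed.

Lemma weighted_form_eq Phi Psi e :
    shift_le Phi Psi -> shift_le Psi Phi ->
    (forall m : 'X_{1..N}, m \in msupp Phi -> (wdeg m <= e)%N) ->
    (forall m : 'X_{1..N}, m \in msupp Psi -> (wdeg m <= e)%N) ->
  forall m : 'X_{1..N}, wdeg m = e -> Phi@_m = Psi@_m.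
Proof.
move=> le1 le2 Phie Psie m me.
have /eqP : weighted_form e Phi - weighted_form e Psi = 0.
  apply: mpoly_eq0_nat => v v0; rewrite mevalB; apply/eqP; rewrite subr_eq0 eq_le.
  by rewrite (weighted_form_le le1) // (weighted_form_le le2).
rewrite subr_eq0 => /eqP/mpolyP/(_ m).
by rewrite !mcoeff_weighted_form me eqxx.
Qed.

End WeightedForms.

(** * Weights realizing the lexicographic orders *)

Section LexWeights.
Variables (N : nat) (j : {perm 'I_N}) (C : nat).
Implicit Types e f : {ffun 'I_N -> nat}.

(** Place values in base [C + 1]: the variable that [j] puts first gets the largest one. *)
Definition lex_weight (k : 'I_N) : nat := (C.+1 ^ (N.-1 - (j^-1)%g k))%N.

Lemma lex_weight_gt0 k : (0 < lex_weight k)%N.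
Proof. by rewrite expn_gt0. Qed.

Lemma wdeg_lex_weight f : wdeg lex_weight f = (\sum_(k < N) C.+1 ^ (N.-1 - k) * f (j k))%N.
Proof.
rewrite /wdeg (reindex_inj (@perm_inj _ j)) /=.
by apply: eq_bigr => k _; rewrite /lex_weight permK.
Qed.

Lemma lex_lt_wdeg f e : (\sum_k f k <= C)%N -> lex_lt j f e ->
  (wdeg lex_weight f < wdeg lex_weight e)%N.
Proof.
move=> fC [k [fe fek]]; rewrite !wdeg_lex_weight.
rewrite (bigD1 k) // [X in (_ < X)%N](bigD1 k) //=.
rewrite (bigID (fun i : 'I_N => i < k)%N) [X in (_ < _ + X)%N](bigID (fun i : 'I_N => i < k)%N) /=.
rewrite (eq_bigr (fun i : 'I_N => C.+1 ^ (N.-1 - i) * e (j i))%N) => [|i /andP[_ ik]];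
  last by rewrite fe.
set W := (C.+1 ^ (N.-1 - k))%N; set A := (\sum_(i < N | _ && (i < k)%N) _)%N.
set R := (\sum_(i < N | _) _)%N; set R' := (\sum_(i < N | _) _)%N.
(* The entries of [f] after position [k] have sum at most [C], so together they weigh less than one
   unit at position [k]. *)
suff RW : (R < W)%N.
  apply: (@leq_trans (W * (f (j k)).+1 + A)%N); first by rewrite mulnS; lia.
  by apply: (@leq_trans (W * e (j k) + A)%N); [rewrite leq_add2r leq_mul2l fek orbT | lia].
rewrite /W; case E : (N.-1 - k)%N => [|d].
  rewrite /R big_pred0 // => i; apply/negP => /andP[ik nik].
  have := ltn_ord i; move: ik nik E; rewrite -val_eqE /=; lia.
apply: (@leq_ltn_trans (C.+1 ^ d * C)%N); last by rewrite expnSr ltn_mul2l expn_gt0 ltnSn.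
apply: (@leq_trans (\sum_(i < N) C.+1 ^ d * f (j i))%N).
  rewrite /R big_mkcond; apply: leq_sum => i _; case: ifP => // /andP[ik nik].
  rewrite leq_mul2r; apply/orP; right; apply: leq_pexp2l => //.
  by have := ltn_ord i; move: ik nik E; rewrite -val_eqE /=; lia.
rewrite -big_distrr leq_mul2l; apply/orP; right; apply: leq_trans fC.
by rewrite [X in (_ <= X)%N](reindex_inj (@perm_inj _ j)).
Qed.

Lemma lex_lt_total e f : e <> f -> lex_lt j e f \/ lex_lt j f e.
Proof.
move=> ef; have [k0 k0P] : exists k, e (j k) != f (j k).
  apply/existsP; rewrite -negb_forall; apply/negP => /forallP efE; apply: ef.
  by apply/ffunP => k; rewrite -[k](permKV j); apply/eqP.
have [k kP kmin] := @arg_minnP _ k0 (fun k => e (j k) != f (j k)) (fun k => k : nat) k0P.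
have below (nu : 'I_N) : (nu < k)%N -> e (j nu) = f (j nu).
  by move=> nuk; apply/eqP/negPn/negP => /kmin; rewrite leqNgt nuk.
case/orP: (leq_total (e (j k)) (f (j k))); rewrite leq_eqVlt ?[f _ == _]eq_sym (negPf kP) /= => lt.
  by left; exists k.
by right; exists k; split=> // nu /below.
Qed.

End LexWeights.

(** * Invariants of a binomial expansion under translation-bounded comparison *)

Section Invariants.
Variables (N : nat) (u : {ffun 'I_N -> nat}).
Implicit Types (a b : {ffun 'I_N -> nat} -> int) (e f : {ffun 'I_N -> nat}).

Lemma wdeg_mle (w : 'I_N -> nat) (f g : 'I_N -> nat) :
  (forall k, f k <= g k)%N -> (wdeg w f <= wdeg w g)%N.
Proof. by move=> fg; apply: leq_sum => k _; rewrite leq_mul2l fg orbT. Qed.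

Lemma wdeg_eq_mle (w : 'I_N -> nat) e f : (forall k, 0 < w k)%N -> mle e f ->
  (wdeg w f <= wdeg w e)%N -> f = e.
Proof.
move=> w0 /mleP ef; rewrite /wdeg => fe; apply/ffunP => k; apply/eqP.
rewrite eqn_leq ef andbT -(leq_pmul2l (w0 k)).
rewrite leqNgt; apply/negP => lt; move: fe; rewrite leqNgt => /negP; apply.
rewrite (bigD1 k) // [X in (_ < X)%N](bigD1 k) //= -addSn; apply: leq_add => //.
by apply: leq_sum => i _; rewrite leq_mul2l ef orbT.
Qed.

Lemma msize_shift_le (Phi Psi : {mpoly rat[N]}) :
  shift_le Phi Psi -> shift_le Psi Phi ->
  msize Phi = msize Psi /\
  forall m : 'X_{1..N}, (mdeg m).+1 = msize Phi -> Phi@_m = Psi@_m.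
Proof.
move=> le1 le2.
have wdeg1 (m : 'X_{1..N}) : wdeg (fun=> 1%N) m = mdeg m.
  by rewrite mdegE; apply: eq_bigr => k _; rewrite mul1n.
(* With all weights 1 the forms are homogeneous components. [msize] is the degree plus one, so [e]
   is the larger of the two degrees. *)
pose e := (maxn (msize Phi) (msize Psi)).-1.
have forms (m : 'X_{1..N}) : mdeg m = e -> Phi@_m = Psi@_m.
  rewrite -wdeg1; apply: weighted_form_eq => // m' /msize_mdeg_lt lt; rewrite wdeg1 /e.
    by rewrite -ltnS (leq_trans lt) // (leq_trans _ (leqSpred _)) // leq_maxl.
  by rewrite -ltnS (leq_trans lt) // (leq_trans _ (leqSpred _)) // leq_maxr.
(* If [P] had larger degree, its leading monomial would have degree [e] and be absent from [Q]. *)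
have key (P Q : {mpoly rat[N]}) : (forall m : 'X_{1..N}, mdeg m = e -> P@_m = Q@_m) ->
    (maxn (msize P) (msize Q)).-1 = e -> (msize P <= msize Q)%N.
  move=> PQ eE; rewrite leqNgt; apply/negP => lt.
  have P0 : P != 0 by apply: contraTneq lt => ->; rewrite msize0.
  have := PQ (mlead P); rewrite (memN_msupp_eq0 (p := Q)) => [/(_ _)/eqP|].
    rewrite mleadc_eq0 (negPf P0) => H; have : false by apply: H;
      rewrite -eE (maxn_idPl (ltnW lt)) -mlead_deg.
    by [].
  apply/negP => /msize_mdeg_lt; rewrite ltnNge => /negP; apply.
  by rewrite -ltnS mlead_deg // ltnW.
have eqs : msize Phi = msize Psi.
  apply/eqP; rewrite eqn_leq !key // => [m /forms->|] //.
  by rewrite maxnC.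
split=> // m me; apply: forms; by rewrite /e -eqs maxnn -me.
Qed.

(** In base [1 + \sum_k u k] the weights turn the lexicographic order on the box into a comparison
    of weighted degrees. Thus [e] is heaviest in its support and its coefficient is read off the
    leading weighted form. *)
Lemma lex_maximal_coef a b j e :
  shift_le (binom_expansion u a) (binom_expansion u b) ->
  shift_le (binom_expansion u b) (binom_expansion u a) ->
  expansion_support u a e ->
  (forall f, expansion_support u a f -> ~ lex_lt j e f) ->
  [/\ a e = b e, expansion_support u b e &
      forall f, expansion_support u b f -> ~ lex_lt j e f].
Proof.
move=> le1 le2 Ea emax; pose w := lex_weight j (\sum_k u k).
have w0 k : (0 < w k)%N by apply: lex_weight_gt0.
have ltw f g : (forall k, f k <= u k)%N -> lex_lt j f g -> (wdeg w f < wdeg w g)%N.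
  by move=> fu; apply: lex_lt_wdeg; apply: leq_sum => k _.
have aw f : expansion_support u a f -> (wdeg w f <= wdeg w e)%N.
  move=> Ef; have [->//|/eqP fe] := eqVneq f e.
  by have [/ltw-/(_ Ef.1)/ltnW //|/emax[]] := lex_lt_total j fe.
have supp_le c g E : (forall f, expansion_support u c f -> (wdeg w f <= E)%N) ->
    g \in msupp (binom_expansion u c) -> (wdeg w g <= E)%N.
  move=> cE /msupp_binom_expansion[f /cE fE gf]; apply: leq_trans fE; exact: wdeg_mle.
have wE (f : {ffun 'I_N -> nat}) : wdeg w (mnm_of f) = wdeg w f.
  by apply: eq_bigr => k _; rewrite mnmE.
have top c f : expansion_support u c f ->
    (forall g, expansion_support u c g -> (wdeg w g <= wdeg w f)%N) ->
    (binom_expansion u c)@_(mnm_of f) = (c f)%:~R / (\prod_k ((f k)`!)%:R).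
  move=> Cf fmax; apply: mcoeff_binom_expansion; first by apply/mleP/Cf.1.
  by move=> g Cg fg; apply: (wdeg_eq_mle w0) => //; apply: fmax.
have fact_neq0 (f : {ffun 'I_N -> nat}) : (\prod_k ((f k)`!)%:R : rat) != 0.
  by rewrite prodf_seq_neq0; apply/allP => k _; rewrite pnatr_eq0 -lt0n fact_gt0.
(* If something in the support of [b] outweighed [e], a heaviest such [g] would give a monomial of
   the expansion of [b] that is too heavy for that of [a], against the equality of forms. *)
have bw f : expansion_support u b f -> (wdeg w f <= wdeg w e)%N.
  move=> Bf; rewrite leqNgt; apply/negP => ltf.
  pose s := [seq g <- mbox u | b g != 0].
  have sP g : (g \in s) <-> expansion_support u b g.
    rewrite mem_filter mem_mbox; split=> [/andP[/eqP bg /mleP gu]|[gu /eqP ->]]; first by split.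
    exact/mleP.
  have [g gs gmax] : exists2 g, g \in s & forall h, h \in s -> (wdeg w h <= wdeg w g)%N.
    have fs : f \in s by apply/sP.
    elim: (s) f fs {Bf ltf sP} => // g0 t IH f _.
    case: t IH => [|g1 t] IH; first by exists g0; rewrite ?mem_head // => h; rewrite inE => /eqP->.
    have [g gt gmax] := IH g1 (mem_head _ _).
    case: (leqP (wdeg w g0) (wdeg w g)) => [le|lt].
      exists g; first by rewrite inE gt orbT.
      by move=> h; rewrite inE => /predU1P[->|/gmax].
    exists g0; first exact: mem_head.
    move=> h; rewrite inE => /predU1P[->//|/gmax hg]; exact: leq_trans hg (ltnW lt).
  have Bg : expansion_support u b g by apply/sP.
  have eg : (wdeg w e < wdeg w g)%N by apply: leq_trans ltf (gmax _ _); apply/sP.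
  have : (binom_expansion u a)@_(mnm_of g) = (binom_expansion u b)@_(mnm_of g).
    apply: (weighted_form_eq w0 le1 le2 _ _ (wE g)).
      by move=> h; apply: supp_le => f' /aw le'; apply: leq_trans le' (ltnW eg).
    by move=> h; apply: supp_le => f' /sP/gmax.
  rewrite (top b) // => [|h /sP/gmax//].
  rewrite memN_msupp_eq0.
    move/esym/eqP; rewrite mulf_eq0 invr_eq0 (negPf (fact_neq0 g)) orbF intr_eq0.
    by move/eqP; apply: Bg.2.
  by apply/negP => /(supp_le _ _ _ aw); rewrite wE leqNgt eg.
have abE : (binom_expansion u a)@_(mnm_of e) = (binom_expansion u b)@_(mnm_of e).
  apply: (weighted_form_eq w0 le1 le2 _ _ (wE e)) => h; exact: supp_le.
(* The monomial at [e] occurs for [b], so it lies below some [f] in the support of [b]; as [f] is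
   not heavier than [e], they are equal. *)
have Be : expansion_support u b e.
  have : mnm_of e \in msupp (binom_expansion u b).
    rewrite mcoeff_msupp -abE top // mulf_eq0 invr_eq0 (negPf (fact_neq0 e)) orbF intr_eq0.
    exact/eqP/Ea.2.
  move/msupp_binom_expansion => [f Bf ef].
  suff <- : f = e by [].
  apply: (wdeg_eq_mle w0); last exact: bw.
  by apply/mleP => k; have := ef k; rewrite mnmE.
split=> //.
- apply/eqP; rewrite -(eqr_int rat); apply/eqP; apply: (mulIf (_ : (\prod_k ((e k)`!)%:R)^-1 != 0)).
    by rewrite invr_eq0 fact_neq0.
  by move: abE; rewrite !top.
- move=> f Bf /ltw-/(_ Be.1); rewrite ltnNge => /negP; apply; exact: bw.
Qed.

Theorem expansion_invariants a b :
  let Phi := binom_expansion u a in let Psi := binom_expansion u b in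
  let Ea := expansion_support u a in let Eb := expansion_support u b in
  shift_le Phi Psi -> shift_le Psi Phi ->
  [/\ msize Phi = msize Psi, a u = b u, lex_maximal Ea = lex_maximal Eb,
      forall e, lex_maximal Ea e -> a e = b e &
      forall mon : 'X_{1..N}, (mdeg mon).+1 = msize Phi -> Phi@_mon = Psi@_mon].
Proof.
move=> Phi Psi Ea Eb le1 le2.
have half c d : shift_le (binom_expansion u c) (binom_expansion u d) ->
    shift_le (binom_expansion u d) (binom_expansion u c) ->
    forall e, lex_maximal (expansion_support u c) e ->
    c e = d e /\ lex_maximal (expansion_support u d) e.
  move=> l1 l2 e [Ce [j jmax]]; have [-> De djmax] := lex_maximal_coef l1 l2 Ce jmax.
  by split=> //; split=> //; exists j.
(* The corner [u], when present, is lexicographically maximal, so the invariance of the top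
   coefficient is a case of that of maximal elements. *)
have u_max c : c u <> 0 -> lex_maximal (expansion_support u c) u.
  move=> cu; split; first by split.
  by exists 1%g => f [fu _] [k [_]]; rewrite ltnNge fu.
have [ms tc] := msize_shift_le le1 le2.
split=> //.
- have [au|/eqP au] := eqVneq (a u) 0; last by case: (half _ _ le1 le2 _ (u_max _ au)).
  have [bu|/eqP bu] := eqVneq (b u) 0; first by rewrite au bu.
  by case: (half _ _ le2 le1 _ (u_max _ bu)) => ->.
- by apply/seteqP; split=> e => [/(half _ _ le1 le2)[]|/(half _ _ le2 le1)[]].
- by move=> e /(half _ _ le1 le2)[].
Qed.

End Invariants.

(** * Dependent power products *)

Section MonomialOrder.
Variables (X : finType) (s : nat).
Implicit Types (i j : {ffun X -> nat} * 'I_s) (x : X).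

(* Pairs are compared as monomials in the variables [X] and one more variable
   whose exponent is the second component. *)
Definition monomial_key i : 'X_{1..#|X|.+1} :=
  [multinom if unlift ord0 k is Some k' then i.1 (enum_val k') else i.2 : nat | k < #|X|.+1].

Definition monomial_lt i j : bool := (monomial_key i < monomial_key j)%O.

Lemma monomial_key_inj : injective monomial_key.
Proof.
move=> [v k] [w l] /mnmP E; congr pair.
  apply/ffunP => x; have := E (lift ord0 (enum_rank x)).
  by rewrite !mnmE liftK /= enum_rankK.
by apply: val_inj; have := E ord0; rewrite !mnmE unlift_none.
Qed.

Lemma monomial_key_mincr x v k : monomial_key (mincr x v, k) =
  (monomial_key (v, k) + U_(lift ord0 (enum_rank x)))%MM.
Proof.
apply/mnmP => l; rewrite mnmDE mnmE mnm1E mnmE; case: (unliftP ord0 l) => [l' ->|->] /=.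
  by rewrite ffunE (inj_eq lift_inj) -(can_eq enum_valK) enum_rankK eq_sym.
by rewrite addn0.
Qed.

Lemma monomial_lt_mincr x v k w l :
  monomial_lt (mincr x v, k) (mincr x w, l) = monomial_lt (v, k) (w, l).
Proof. by rewrite /monomial_lt !monomial_key_mincr ltmc_add2l. Qed.

Lemma monomial_lt_mincrr x v k : monomial_lt (v, k) (mincr x v, k).
Proof.
rewrite /monomial_lt monomial_key_mincr lt_neqAle lemc_addr andbT.
apply/eqP => /mnmP/(_ (lift ord0 (enum_rank x))); rewrite mnmDE mnm1E eqxx.
by move=> /eqP; rewrite -{1}[monomial_key _ _]addn0 eqn_add2l.
Qed.

Lemma monomial_lt_trans j i k : monomial_lt i j -> monomial_lt j k -> monomial_lt i k.
Proof. exact: lt_trans. Qed.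

Lemma monomial_ltxx i : monomial_lt i i = false.
Proof. exact: ltxx. Qed.

Lemma monomial_lt_asym i j : monomial_lt i j -> ~~ monomial_lt j i.
Proof. by move=> ij; rewrite -leNgt ltW. Qed.

End MonomialOrder.

(** * Dependent and independent pairs in a box *)

Section Orbit.
Variables (L : fieldType) (charL0 : [pchar L] =i pred0) (m n p : nat) (mm : 'I_p -> nat).
Hypothesis sum_mm : (\sum_(k < p) mm k)%N = m.
Variables (D : dsStructure m n L) (K : set L) (dsK : ds_subfield D K).

Local Notation X := (operator m n).
Local Notation kd := (@op_kind m n p mm).
Local Notation deg := (mdegree kd).

Lemma auti_rmorphism j : exists f : {rmorphism L -> L}, f =1 auti D j.
Proof.
have add : zmod_morphism (auti D j).
  by move=> x y; apply: (can_inj (autK D j)); rewrite rmorphB !autiK.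
have mul : monoid_morphism (auti D j).
  split; first by apply: (can_inj (autK D j)); rewrite rmorph1 autiK.
  by move=> x y; apply: (can_inj (autK D j)); rewrite rmorphM !autiK.
pose f : {rmorphism L -> L} := HB.pack (auti D j)
  (GRing.isZmodMorphism.Build _ _ _ add) (GRing.isMonoidMorphism.Build _ _ _ mul).
by exists f.
Qed.

Lemma aut_op_acl j S x : acl K S x -> acl K (op_act D (inr j) @` S) (op_act D (inr j) x).
Proof.
case: dsK => _ _ Kaut Kauti; case: j => j /=; first exact/morphism_acl/Kaut.
have [f fE] := auti_rmorphism j; have fK y : K y -> K (f y) by rewrite fE; apply: Kauti.
move=> /(morphism_acl fK); rewrite fE; suff -> : f @` S = auti D j @` S by [].
by apply: eq_imagel => y _; rewrite fE.
Qed.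

(** A derivation brings in both [S] and its image; keeping this form for automorphisms treats all
    operators at once. *)
Lemma op_acl x S z : acl K S z -> acl K (S `|` op_act D x @` S) (op_act D x z).
Proof.
case: x => [i|j].
  by case: dsK => _ Kder _ _; apply: (derivation_acl (derM D i) charL0 (Kder i)).
by move=> /(aut_op_acl j); apply: aclS; apply: subsetUr.
Qed.

Lemma op_field_gen x S z :
  field_gen K S z -> field_gen K (S `|` op_act D x @` S) (op_act D x z).
Proof.
case: dsK => _ Kder Kaut Kauti; have sF := field_gen_subfield K (S `|` op_act D x @` S).
case: x sF => [i|j] sF.
  apply: derivation_field_gen => //; first exact: derM.
  - by apply: field_genS => y; left.
  - by move=> y Ky; apply: sub_field_genl; apply: Kder.
  - by move=> y Sy; apply: sub_field_genr; right; exists y.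
move=> Sz; suff : field_gen K (op_act D (inr j) @` S) (op_act D (inr j) z).
  by apply: field_genS => y; right.
case: j {sF} => j /=; first by apply: morphism_field_gen => // y; apply: Kaut.
have [f fE] := auti_rmorphism j; have fK y : K y -> K (f y) by rewrite fE; apply: Kauti.
move: Sz => /(morphism_field_gen fK); rewrite fE; suff -> : f @` S = auti D j @` S by [].
by apply: eq_imagel => y _; rewrite fE.
Qed.

Variables (s : nat) (eta : 'I_s -> L).

Definition orbit_pt (i : {ffun X -> nat} * 'I_s) : L := pp_act D (pp_of i.1) (eta i.2).

Lemma orbit_pt_mincr x v j : orbit_pt (mincr x v, j) = op_act D x (orbit_pt (v, j)).
Proof. exact: pp_act_mincr. Qed.

Definition in_box (r : 'I_p.+1 -> nat) (i : {ffun X -> nat} * 'I_s) : bool :=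
  [forall k, deg i.1 k <= r k]%N.

Lemma in_boxP r i : reflect (forall k, deg i.1 k <= r k)%N (in_box r i).
Proof. exact: forallP. Qed.

Lemma box_orbitE r : box_orbit D mm eta r = [set orbit_pt i | i in [set i | in_box r i]].
Proof.
apply/seteqP; split=> z.
  move=> [j [lam [/= lamr ->]]]; have [v vlam vE] := pp_of_surj sum_mm lam.
  exists (v, j); last by rewrite -vlam.
  by apply/in_boxP => k; rewrite vE; exact: (lamr k).
move=> [[v j] /in_boxP vr <-]; exists j, (pp_of v); split=> // k.
exact: leq_trans (pp_ord_le sum_mm v k) (vr k).
Qed.

Definition dependent (r : 'I_p.+1 -> nat) i : Prop :=
  acl K [set orbit_pt b | b in [set b | monomial_lt b i /\ in_box r b]] (orbit_pt i).

Lemma dependent_le r r' i : (forall k, r k <= r' k)%N -> dependent r i -> dependent r' i.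
Proof.
move=> rr'; apply: aclS => _ [b [bi /in_boxP br] <-]; exists b => //; split=> //.
by apply/in_boxP => k; apply: leq_trans (rr' k).
Qed.

(** Applying [x] to a relation brings in the old pairs and their multiples by [x]. All are below the
    new pair, as the order is compatible with multiplication, and lie in the box enlarged by one in
    the component of [x]. *)
Lemma dependent_mincr r r' x v j : (forall k, r k + (k == kd x) <= r' k)%N ->
  dependent r (v, j) -> dependent r' (mincr x v, j).
Proof.
move=> rr' /(op_acl x); rewrite /dependent orbit_pt_mincr; apply: aclS => t [|].
  move=> [b [bi /in_boxP br] <-]; exists b => //; split.
    exact: monomial_lt_trans bi (monomial_lt_mincrr _ _ _).
  by apply/in_boxP => k; apply: leq_trans (br k) (leq_trans (leq_addr _ _) (rr' k)).
move=> [t' [[w l] [bi /in_boxP br] <-] <-]; exists (mincr x w, l); last exact: orbit_pt_mincr.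
split; first by rewrite monomial_lt_mincr.
apply/in_boxP => k; rewrite /= mdegree_mincr; apply: leq_trans (rr' k).
by rewrite leq_add2r; apply: br.
Qed.

(** Cancelling one automorphism against its inverse leaves a smaller word with the same point. *)
Lemma dependent_redundant r v j l : in_box r (v, l) ->
  (0 < v (inr (inl j)))%N -> (0 < v (inr (inr j)))%N -> dependent r (v, l).
Proof.
move=> /in_boxP vr va vb.
pose w : {ffun X -> nat} := [ffun x => v x - (x == inr (inl j)) - (x == inr (inr j))]%N.
have vE : v = mincr (inr (inl j)) (mincr (inr (inr j)) w).
  apply/ffunP => x; rewrite /w !ffunE; case: (eqVneq x (inr (inl j))) => [->|_].
    by rewrite (_ : (inr (inl j) == inr (inr j)) = false) // !subn0 addn0 subn1 addn1 prednK.
  by rewrite subn0 addn0; case: eqP => [->|_]; rewrite ?subn0 ?addn0 ?subn1 ?addn1 ?prednK.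
have lt_w : monomial_lt (w, l) (v, l).
  rewrite vE; apply: monomial_lt_trans (monomial_lt_mincrr _ _ _); exact: monomial_lt_mincrr.
apply: sub_acl; exists (w, l); last first.
  by rewrite vE !orbit_pt_mincr op_act_mul_inv.
split=> //; apply/in_boxP => k; apply: leq_trans (vr k).
by rewrite /= vE !mdegree_mincr -addnA leq_addr.
Qed.

Definition box_monomials (r : 'I_p.+1 -> nat) : seq {ffun X -> nat} :=
  [seq v <- mbox [ffun x => r (kd x)] | [forall k, deg v k <= r k]%N].

Lemma mem_box_monomials r v : (v \in box_monomials r) = [forall k, deg v k <= r k]%N.
Proof.
rewrite mem_filter mem_mbox andb_idr // => /forallP vr.
by apply/mleP => x; rewrite ffunE (leq_trans (leq_mdegree kd v x)).
Qed.

Lemma box_monomials_uniq r : uniq (box_monomials r).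
Proof. exact/filter_uniq/mbox_uniq. Qed.

Definition box_pairs (r : 'I_p.+1 -> nat) : seq ({ffun X -> nat} * 'I_s) :=
  sort (fun i j => monomial_key i <= monomial_key j)%O
       [seq (v, j) | v <- box_monomials r, j <- enum 'I_s].

Lemma mem_box_pairs r i : (i \in box_pairs r) = in_box r i.
Proof.
rewrite mem_sort /in_box -mem_box_monomials; apply/allpairsP/idP => [[[v j] /= [vr _ ->]]//|ir].
by exists i; rewrite mem_enum; split=> //; apply: surjective_pairing.
Qed.

Lemma box_pairs_sorted r : pairwise (@monomial_lt X s) (box_pairs r).
Proof.
rewrite -(pairwise_map (@monomial_key X s) <%O).
rewrite -(sorted_pairwise lt_trans) lt_sorted_uniq_le map_inj_uniq; last exact: monomial_key_inj.
rewrite sort_uniq allpairs_uniq ?box_monomials_uniq ?enum_uniq //=; last by move=> [? ?] [? ?].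
by rewrite sorted_map; apply: sort_sorted => i j; apply: le_total.
Qed.

Definition basis_pairs r := [seq i <- box_pairs r | ~~ `[< dependent r i >]].

Lemma basis_pairsP r :
  prefix_indep (acl K) set0 (map orbit_pt (basis_pairs r)) /\
  box_orbit D mm eta r `<=` acl K [set` map orbit_pt (basis_pairs r)].
Proof.
have := increasing_basis (@sub_acl _ K) (@acl_sub _ K) orbit_pt set0
  (@monomial_ltxx X s) (@monomial_lt_asym X s) (box_pairs_sorted r).
have -> : [seq i <- box_pairs r | ~~ `[< acl K (set0 `|` [set orbit_pt j | j in
     [set j | j \in box_pairs r /\ monomial_lt j i]]) (orbit_pt i) >]] = basis_pairs r.
  apply: eq_filter => i; congr (~~ `[< acl K _ _ >]); rewrite set0U.
  congr (_ @` _); apply/seteqP; split=> b /= [].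
    by rewrite mem_box_pairs.
  by rewrite mem_box_pairs.
case=> ind span; split=> // z; rewrite box_orbitE => -[i ir <-].
have /span : [set` map orbit_pt (box_pairs r)] (orbit_pt i).
  by rewrite /= map_f // mem_box_pairs.
by apply: aclS => t [].
Qed.

Lemma has_trdeg_box r :
  has_trdeg K (field_gen K (box_orbit D mm eta r)) (size (basis_pairs r)).
Proof.
have [ind span] := basis_pairsP r; case: dsK => sK _ _ _.
apply/(has_trdegP sK); exists (map orbit_pt (basis_pairs r)); split=> //.
- by rewrite size_map.
- move=> t /= /mapP[i]; rewrite mem_filter mem_box_pairs => /andP[_ ir] ->.
  by apply: sub_field_genr; rewrite box_orbitE; exists i.
- exact: sub_acl_field_gen.
Qed.

End Orbit.

(** * Orthants and the dimension polynomial *)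

Section Orthants.
Variables (m n p : nat) (mm : 'I_p -> nat).
Hypothesis sum_mm : (\sum_(k < p) mm k)%N = m.

Local Notation X := (operator m n).
Local Notation kd := (@op_kind m n p mm).
Local Notation deg := (mdegree kd).

(* The variables counting one orthant: a slack variable for each component of
   the multidegree, the derivations, and one exponent for each automorphism,
   carried by [aut] or by its inverse according to the orthant. *)
Definition orth_var : finType := ('I_p.+1 + ('I_m + 'I_n))%type.

Definition orth_kind (x : orth_var) : 'I_p.+1 :=
  match x with
  | inl k => k
  | inr (inl nu) => kd (inl nu)
  | inr (inr _) => ord_max
  end.

Local Notation degz := (mdegree orth_kind).
Implicit Types (z : {ffun orth_var -> nat}) (eps : {ffun 'I_n -> bool}).

(** The slack variable accounts for the successor, so that component [k] contributes
    [C(r_k + u_k, u_k)] monomials, with [u_k] the block size. *)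
Lemma card_orth_kind k :
  #|[pred x | orth_kind x == k]| = (block_sizes n mm k).+1.
Proof.
rewrite -sum1_card big_sumType /= (big_pred1 k) // add1n; congr _.+1.
rewrite big_sumType /= ffunE; case: unliftP => [i ->|->].
  rewrite [X in (_ + X)%N]big1 ?addn0; last first.
    by move=> j; rewrite inE /= (negPf (neq_lift _ _)).
  rewrite -(card_in_block sum_mm i) -sum1_card; apply: eq_bigl => nu.
  by rewrite !inE -(op_kind_der n sum_mm).
rewrite big1 ?add0n; last first.
  move=> nu; have [i inu] := in_block_exists sum_mm nu.
  have E : orth_kind (inr (inl nu)) = lift ord_max i.
    by apply/eqP; rewrite (op_kind_der n sum_mm).
  by rewrite inE E eq_sym (negPf (neq_lift _ _)).
rewrite (eq_bigl xpredT) => [|j]; last by rewrite inE /= eqxx.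
by rewrite sum1_card card_ord.
Qed.

Definition orth_embed eps z : {ffun X -> nat} := [ffun x => match x with
  | inl nu => z (inr (inl nu))
  | inr (inl i) => if eps i then z (inr (inr i)) else 0
  | inr (inr i) => if eps i then 0 else z (inr (inr i))
  end]%N.

(** An inverse automorphism must occur with positive exponent, so that words with exponent 0 fall in
    one orthant only. *)
Definition orth_base eps : {ffun orth_var -> nat} := [ffun x =>
  if x is inr (inr i) then ~~ eps i : nat else 0%N].

Definition normal_form (v : {ffun X -> nat}) : bool :=
  [forall i, (v (inr (inl i)) == 0%N) || (v (inr (inr i)) == 0%N)].

Definition sign_of (v : {ffun X -> nat}) : {ffun 'I_n -> bool} :=
  [ffun i => v (inr (inr i)) == 0%N].

(** The slack fills up the multidegree: words of a box become monomials of one exact multidegree. *)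
Lemma degz_embed eps z k : degz z k = (z (inl k) + deg (orth_embed eps z) k)%N.
Proof.
rewrite !ffunE [in LHS]big_sumType /= big_pred1_eq; congr (_ + _)%N.
rewrite [in LHS]big_sumType [in RHS]big_sumType /=; congr (_ + _)%N.
  by apply: eq_bigr => nu _; rewrite ffunE.
rewrite big_sumType /= -big_split /=.
by apply: eq_bigr => i _; rewrite !ffunE; case: ifP; rewrite ?addn0 ?add0n.
Qed.

Lemma orth_embed_inj eps z z' :
  degz z = degz z' -> orth_embed eps z = orth_embed eps z' -> z = z'.
Proof.
move=> dz ez; have /ffunP ez' := ez; apply/ffunP => -[k|[nu|i]].
- have : degz z k = degz z' k by rewrite dz.
  by rewrite !(degz_embed eps) ez => /addIn.
- by have := ez' (inl nu); rewrite !ffunE.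
- have := ez' (inr (inl i)); have := ez' (inr (inr i)); rewrite !ffunE.
  by case: ifP.
Qed.

Lemma orth_embed_mincr eps z x :
  orth_embed eps (mincr x z) =
  match x with
  | inl _ => orth_embed eps z
  | inr (inl nu) => mincr (inl nu) (orth_embed eps z)
  | inr (inr i) => mincr (inr (if eps i then inl i else inr i)) (orth_embed eps z)
  end.
Proof.
apply/ffunP => -[nu|[i|i]]; case: x => [k|[nu'|i']]; rewrite !ffunE ?addn0 //.
all: try by case: (eps i').
all: rewrite /= ?if_same //.
- have -> : (inr (inl i) == inr (if eps i' then inl i' else inr i') :> X) = eps i' && (i == i').
    by case: (eps i').
  rewrite -[X in nat_of_bool X]/(i == i').
  have [->|_] := eqVneq i i'; last by rewrite andbF !addn0.
  by case: (eps i').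
- have -> : (inr (inr i) == inr (if eps i' then inl i' else inr i') :> X) = ~~ eps i' && (i == i').
    by case: (eps i').
  rewrite -[X in nat_of_bool X]/(i == i').
  have [->|_] := eqVneq i i'; last by rewrite andbF !addn0.
  by case: (eps i').
Qed.

Lemma normal_form_embed eps z : normal_form (orth_embed eps z).
Proof. by apply/forallP => i; rewrite !ffunE; case: ifP; rewrite eqxx ?orbT. Qed.

Lemma sign_of_embed eps z : mle (orth_base eps) z -> sign_of (orth_embed eps z) = eps.
Proof.
move=> /mleP bz; apply/ffunP => i; rewrite !ffunE; have := bz (inr (inr i)).
by rewrite ffunE; case: (eps i) => //=; case: (z _).
Qed.

Lemma orth_embed_surj v (r : {ffun 'I_p.+1 -> nat}) :
  normal_form v -> (forall k, deg v k <= r k)%N ->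
  exists z, [/\ mle (orth_base (sign_of v)) z, degz z = r & orth_embed (sign_of v) z = v].
Proof.
move=> /forallP nv vr.
pose z : {ffun orth_var -> nat} := [ffun x => match x with
  | inl k => r k - deg v k
  | inr (inl nu) => v (inl nu)
  | inr (inr i) => v (inr (inl i)) + v (inr (inr i))
  end]%N.
have ez : orth_embed (sign_of v) z = v.
  apply/ffunP => -[nu|[i|i]]; rewrite !ffunE //; have := nv i.
    by case: (v (inr (inr i)) =P 0%N) => [->|_]; rewrite ?addn0 // orbF => /eqP.
  by case: (v (inr (inr i)) =P 0%N) => [->|_] //; rewrite orbF => /eqP->.
exists z; split=> //.
  apply/mleP => -[k|[nu|i]]; rewrite !ffunE //; case: eqP => //= vi.
  by rewrite addn_gt0 [X in _ || X]lt0n; apply/orP; right; apply/eqP.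
by apply/ffunP => k; rewrite (degz_embed (sign_of v)) ez ffunE subnK.
Qed.

(** The sign vector splits the normal forms, and [orth_embed] identifies each class with the
    monomials of multidegree [r] above [orth_base]. *)
Lemma count_orthants (r : {ffun 'I_p.+1 -> nat}) (Q : pred {ffun X -> nat}) :
  count (fun v => normal_form v && Q v) (@box_monomials m n p mm r) =
  (\sum_(eps : {ffun 'I_n -> bool})
     size [seq z <- mons orth_kind r | mle (orth_base eps) z & Q (orth_embed eps z)])%N.
Proof.
rewrite -sum1_count (partition_big sign_of xpredT) //=; apply: eq_bigr => eps _.
rewrite sum1_count -size_filter -(size_map (orth_embed eps)).
apply/perm_size/uniq_perm.
- exact/filter_uniq/box_monomials_uniq.
- rewrite map_inj_in_uniq; first exact/filter_uniq/mons_uniq.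
  move=> z z'; rewrite mem_filter mem_mons => /andP[_ /eqP dz].
  by rewrite mem_filter mem_mons => /andP[_ /eqP dz']; apply: orth_embed_inj; rewrite dz.
move=> v; rewrite mem_filter mem_box_monomials; apply/idP/mapP.
- move=> /andP[/andP[/andP[nv Qv] /eqP se] /forallP vr].
  have [z [bz dz ez]] := orth_embed_surj nv vr; rewrite se in bz ez; exists z => //.
  by rewrite mem_filter mem_mons bz ez Qv dz eqxx.
- move=> [z]; rewrite mem_filter mem_mons => /andP[/andP[bz Qz] /eqP dz] ->.
  rewrite normal_form_embed Qz sign_of_embed // eqxx /=; apply/forallP => k.
  by rewrite -dz (degz_embed eps) leq_addl.
Qed.

End Orthants.

(** * Dependence inside an orthant and translations *)

Section OrthantDependence.
Variables (L : fieldType) (charL0 : [pchar L] =i pred0) (m n p : nat) (mm : 'I_p -> nat).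
Hypothesis sum_mm : (\sum_(k < p) mm k)%N = m.
Variables (D : dsStructure m n L) (K : set L) (dsK : ds_subfield D K).

Local Notation X := (operator m n).
Local Notation Z := (orth_var m n p).
Local Notation kd := (@op_kind m n p mm).
Local Notation deg := (mdegree kd).
Local Notation degz := (mdegree (@orth_kind m n p mm)).
Local Notation act v := (pp_act D (pp_of v)).

Lemma pp_act0 z : act [ffun=> 0%N] z = z.
Proof.
have id_big (I : Type) (r : seq I) (f : I -> L -> L) y : (forall i, f i =1 id) ->
    (\big[(fun f g : L -> L => f \o g)/id]_(i <- r) f i) y = y.
  by move=> fid; elim: r => [|i r IH]; rewrite ?big_nil // big_cons /= IH fid.
by rewrite /pp_act !id_big // => i y; rewrite !ffunE ?subrr.
Qed.

Lemma pp_act_madd v w z : act (madd v w) z = act w (act v z).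
Proof.
pose o : {ffun X -> nat} := [ffun=> 0%N].
have ow : mle o w by apply/mleP => x; rewrite ffunE.
move: w ow; apply: mincr_ind => [|x w _ IH].
  by rewrite pp_act0; congr (act _ z); apply/ffunP => x; rewrite !ffunE addn0.
have -> : madd v (mincr x w) = mincr x (madd v w).
  by apply/ffunP => y; rewrite !ffunE addnA.
by rewrite !pp_act_mincr IH.
Qed.

(** A word without derivations is a composite of automorphisms preserving [K], which carry relations
    along coefficient by coefficient. *)
Lemma aut_part_acl (w : {ffun X -> nat}) : (forall nu, w (inl nu) = 0%N) ->
  forall S x, acl K S x -> acl K (act w @` S) (act w x).
Proof.
pose o : {ffun X -> nat} := [ffun=> 0%N].
have ow : mle o w by apply/mleP => x; rewrite ffunE.
move: w ow; apply: mincr_ind => [_|x w _ IH w0] S y.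
  rewrite pp_act0; suff -> : act o @` S = S by [].
  by rewrite -[RHS]image_id; apply: eq_imagel => t _; rewrite pp_act0.
case: x w0 => [nu w0|i w0 Sy]; first by have := w0 nu; rewrite ffunE eqxx addn1.
have w00 nu : w (inl nu) = 0%N by have := w0 nu; rewrite ffunE => /eqP;
  rewrite addn_eq0 => /andP[/eqP].
have /(aut_op_acl dsK i) := IH w00 _ _ Sy; rewrite pp_act_mincr; apply: aclS.
move=> _ [_ [t St <-] <-]; exists t => //; exact: pp_act_mincr.
Qed.

Definition orth_shift (eps : {ffun 'I_n -> bool}) (M : nat) : {ffun X -> nat} :=
  [ffun x => match x with
  | inl _ => 0
  | inr (inl i) => if eps i then M else 0
  | inr (inr i) => if eps i then 0 else M
  end]%N.

Lemma orth_shiftK eps M z :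
  act (orth_shift eps M) (act (orth_shift [ffun i => ~~ eps i] M) z) = z.
Proof.
rewrite -pp_act_madd -[RHS]pp_act0; congr (pp_act D _ z).
by congr pair; apply/ffunP => i; rewrite !ffunE //=; case: (eps i);
  rewrite ?subrr ?addn0 ?add0n ?subrr.
Qed.

Lemma orth_shift_acl eps M S x :
  acl K S x -> acl K (act (orth_shift eps M) @` S) (act (orth_shift eps M) x).
Proof. by apply: aut_part_acl => nu; rewrite ffunE. Qed.

Variables (s : nat) (eta : 'I_s -> L).
Local Notation pt := (orbit_pt D eta).
Local Notation dep := (dependent mm D K eta).

(** The box is the full multidegree of [z], slack included: raising a slack variable enlarges the
    box and keeps the word, which makes this set up-closed in all variables. *)
Definition orth_dependent j eps (z : {ffun Z -> nat}) : Prop :=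
  dep (degz z) (orth_embed eps z, j).

Lemma orth_dependent_upclosed j eps : upclosed (orth_dependent j eps).
Proof.
move=> z z' zz' Uz; move: z' zz'; apply: mincr_ind => // x z' _.
rewrite /orth_dependent orth_embed_mincr; case: x => [k|[nu|i]] Uz'.
- by apply: dependent_le Uz' => l; rewrite mdegree_mincr leq_addr.
- by apply: (dependent_mincr charL0 dsK) Uz' => l; rewrite mdegree_mincr.
- apply: (dependent_mincr charL0 dsK) Uz' => l; rewrite mdegree_mincr.
  by case: (eps i).
Qed.

(** Words containing an automorphism and its inverse are dependent, so only normal forms remain, and
    these split into orthants. *)
Lemma size_basis_pairs (r : {ffun 'I_p.+1 -> nat}) :
  size (basis_pairs mm D K eta r) =
  (\sum_(j < s) \sum_(eps : {ffun 'I_n -> bool})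
     size [seq z <- mons (@orth_kind m n p mm) r |
             mle (@orth_base m n p eps) z && ~~ `[< orth_dependent j eps z >]])%N.
Proof.
rewrite size_filter (seq.permP (permEl (perm_sort _ _))) -sum1_count.
rewrite big_mkcond big_allpairs_dep /= (eq_bigr (fun v => \sum_(j < s | ~~ `[< dep r (v, j)
  >]) 1)%N).
  rewrite (exchange_big_dep xpredT) //=; apply: eq_bigr => j _.
  rewrite sum1_count; under eq_in_count => v.
    rewrite mem_box_monomials => vr.
    have -> : ~~ `[< dep r (v, j) >] = normal_form v && ~~ `[< dep r (v, j) >].
      rewrite andb_idl //; apply: contraNT => /forallPn[i]; rewrite negb_or -!lt0n => /andP[va vb].
      by apply/asboolP; apply: dependent_redundant va vb.
    over.
  rewrite (count_orthants mm r (fun v => ~~ `[< dep r (v, j) >])); apply: eq_bigr => eps _.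
  congr size; apply: eq_in_filter => z; rewrite mem_mons => /eqP dz.
  by rewrite /orth_dependent dz.
by move=> v _; rewrite big_enum /= [RHS]big_mkcond.
Qed.

Local Notation u := (block_sizes n mm).
Local Notation nf_box r := [seq v <- @box_monomials m n p mm r | normal_form v].

Lemma normal_form_inj (v w : {ffun X -> nat}) : normal_form v -> normal_form w ->
  pp_of v = pp_of w -> v = w.
Proof.
move=> /forallP nv /forallP nw [/ffunP dv /ffunP av]; apply/ffunP => -[nu|[i|i]].
- by have := dv nu; rewrite !ffunE.
- have := av i; rewrite !ffunE; have := nv i; have := nw i.
  by move: (v _) (v _) (w _) (w _) => a b c d /orP[]/eqP -> /orP[]/eqP ->; lia.
- have := av i; rewrite !ffunE; have := nv i; have := nw i.
  by move: (v _) (v _) (w _) (w _) => a b c d /orP[]/eqP -> /orP[]/eqP ->; lia.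
Qed.

(* A large power of automorphisms moves all power products of a box into the
   orthant of [eps], where the orbits of the [eta j] with [j \in J] are
   independent; as it acts by an automorphism, they are independent in the box. *)
Lemma independent_orthant_le eps (J : {set 'I_s}) (r : {ffun 'I_p.+1 -> nat}) :
  (forall j, j \in J -> forall z, ~ orth_dependent j eps z) ->
  (#|J| * size (nf_box r) <= size (basis_pairs mm D K eta r))%N.
Proof.
move=> indJ.
have [M leM] : exists M, forall v x, v \in nf_box r -> (v x <= M)%N.
  exists (\sum_k r k)%N => v x; rewrite mem_filter mem_box_monomials => /andP[_ /forallP vr].
  apply: leq_trans (leq_mdegree kd v x) _; apply: leq_trans (vr _) _.
  by rewrite (bigD1 (kd x)) //= leq_addr.
pose tau := orth_shift eps M.
(* Exponents after the translation: as [M] bounds every exponent of [v], the subtractions are exact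
   and all automorphisms point in the direction [eps]. *)
pose core (v : {ffun X -> nat}) (x : Z) : nat := match x with
  | inl k => 0
  | inr (inl nu) => v (inl nu)
  | inr (inr i) => if eps i then M + v (inr (inl i)) - v (inr (inr i))
                   else M + v (inr (inr i)) - v (inr (inl i))
  end%N.
pose sh v : {ffun X -> nat} := orth_embed eps [ffun x => core v x].
(* A sum bounds the multidegrees of all translated words. *)
pose R : {ffun 'I_p.+1 -> nat} := [ffun k => \sum_(v <- nf_box r) deg (sh v) k]%N.
have shR v k : v \in nf_box r -> (deg (sh v) k <= R k)%N.
  by move=> vr; rewrite [R k]ffunE (big_rem v) //= leq_addr.
have shE v : v \in nf_box r -> pp_of (sh v) = pp_of (madd v tau).
  move=> vr; congr pair; apply/ffunP => i; rewrite !ffunE ?addn0 //=.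
  have := leM _ (inr (inl i)) vr; have := leM _ (inr (inr i)) vr.
  by case: (eps i); rewrite ?addn0; move: (v _) (v _) => a b; lia.
pose phi := act tau; pose psi := act (orth_shift [ffun i => ~~ eps i] M).
have phiK z : phi (psi z) = z by apply: orth_shiftK.
have psiK z : psi (phi z) = z.
  rewrite -[RHS](orth_shiftK [ffun i => ~~ eps i] M); congr (psi (act (orth_shift _ M) z)).
  by apply/ffunP => i; rewrite !ffunE negbK.
have pt_sh v j : v \in nf_box r -> pt (sh v, j) = phi (pt (v, j)).
  by move=> vr; rewrite /orbit_pt /= shE // pp_act_madd.
pose I := [seq (sh v, j) | v <- nf_box r, j <- enum J].
have uI : uniq I.
  apply: allpairs_uniq; [exact/filter_uniq/box_monomials_uniq | exact: enum_uniq |].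
  move=> _ _ /allpairsP[[v j] [/= vr _ ->]] /allpairsP[[w l] [/= wr _ ->]] /= [svw ->].
  congr pair; have := vr; have := wr; rewrite !mem_filter => /andP[nw _] /andP[nv _].
  apply: normal_form_inj => //; have := congr1 (@pp_of m n) svw; rewrite !shE //.
  move=> [/ffunP dvw /ffunP avw]; congr pair; apply/ffunP => i.
    by have := dvw i; rewrite !ffunE !addn0.
  have := avw i; rewrite !ffunE.
  by move: (v _) (v _) (w _) (w _) (if _ then _ else _) (if _ then _ else _); lia.
pose B := [seq i <- basis_pairs mm D K eta R | i \in I].
(* By [indJ] every translated pair is independent in the box [R], hence is one of its basis
   pairs. *)
have BI : perm_eq B I.
  apply: uniq_perm => //.
    do 2 apply: filter_uniq; rewrite sort_uniq.
    by rewrite allpairs_uniq ?box_monomials_uniq ?enum_uniq // => -[? ?] [? ?].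
  move=> i; rewrite mem_filter andb_idr // => /allpairsP[[v j] [/= vr jJ ->]].
  rewrite mem_filter mem_box_pairs; apply/andP; split; last first.
    by apply/in_boxP => k; apply: shR.
  apply/asboolP; rewrite mem_enum in jJ; have := indJ j jJ.
  move=> /(_ [ffun x => if x is inl k then R k - deg (sh v) k else core v x]%N).
  rewrite /orth_dependent.
  have -> : orth_embed eps [ffun x => if x is inl k then R k - deg (sh v) k else core v x]%N = sh v.
    by apply/ffunP => -[nu|[l|l]]; rewrite !ffunE.
  suff -> : degz [ffun x => if x is inl k then R k - deg (sh v) k else core v x]%N = R by [].
  apply/ffunP => k; rewrite (degz_embed mm eps) ffunE.
  suff -> : orth_embed eps [ffun x => if x is inl k then R k - deg (sh v) k else core v x]%N = sh v.
    by rewrite subnK // shR.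
  by apply/ffunP => -[nu|[l|l]]; rewrite !ffunE.
have sB : size B = (#|J| * size (nf_box r))%N.
  by rewrite (perm_size BI) size_allpairs mulnC -cardE.
have [indR _] := basis_pairsP sum_mm D K eta R.
have [_ spanr] := basis_pairsP sum_mm D K eta r.
(* Translating back by [psi] keeps independence and lands in the span of the box [r]. *)
rewrite -sB -(size_map pt B) -(size_map psi) -[X in (_ <= X)%N](size_map pt).
apply: (indep_size_le (K := K)).
- apply: (prefix_indep_map (g := phi)) => [S x|]; first exact: orth_shift_acl.
  rewrite image_set0 -map_comp (eq_map phiK) map_id.
  apply: (prefix_indep_subseq (@sub_acl _ K) (@acl_sub _ K)) indR.
  by apply/map_subseq/filter_subseq.
- move=> _ /= /mapP[_ /mapP[i iB ->] ->].
  move: iB; rewrite (perm_mem BI) => /allpairsP[[v j] [/= vr _ ->]].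
  rewrite pt_sh // psiK; apply: spanr; rewrite box_orbitE //; exists (v, j) => //.
  by move: vr; rewrite mem_filter mem_box_monomials => /andP[_ /forallP vr]; apply/in_boxP.
Qed.

End OrthantDependence.

Section TopCoefficient.
Variables (N : nat) (u : {ffun 'I_N -> nat}).

(** In the box below [u] only [u] itself has total degree [\sum_k u k]. *)
Lemma weighted_form_binom_expansion a :
  weighted_form (fun=> 1%N) (\sum_k u k) (binom_expansion u a) =
  ((a u)%:~R / (\prod_k ((u k)`!)%:R)) *: 'X_[mnm_of u].
Proof.
apply/mpolyP => m; rewrite mcoeff_weighted_form mcoeffZ mcoeffX.
have wdeg1 (f : 'I_N -> nat) : wdeg (fun=> 1%N) f = (\sum_k f k)%N.
  by apply: eq_bigr => k _; rewrite mul1n.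
have umax f : expansion_support u a f -> mle u f -> f = u.
  by move=> [fu _] /mleP uf; apply/ffunP => k; apply/eqP; rewrite eqn_leq fu uf.
have [<-|um] := eqVneq (mnm_of u) m.
  rewrite mulr1 wdeg1 (eq_bigr u) => [|k _]; last by rewrite mnmE.
  by rewrite eqxx mcoeff_binom_expansion // mle_refl.
rewrite mulr0; case: eqP => // mu; apply: memN_msupp_eq0.
apply: contraNN um => /msupp_binom_expansion[f [fu _] mf]; apply/eqP.
have mleu k : (m k <= u k)%N by apply: leq_trans (mf k) (fu k).
pose m' : {ffun 'I_N -> nat} := [ffun k => m k].
suff uE : u = m' by rewrite uE; apply/mnmP => k; rewrite mnmE ffunE.
apply: (@wdeg_eq_mle _ (fun=> 1%N)) => //; first by apply/mleP => k; rewrite ffunE.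
have -> : wdeg (fun=> 1%N) m' = wdeg (fun=> 1%N) m by apply: eq_bigr => k _; rewrite ffunE.
by rewrite mu wdeg1.
Qed.

(** The inequality passes to the forms of top degree, evaluated at [(1, ..., 1)]: there they are
    [a u] and [b u] over the same product of factorials. *)
Lemma binom_value_top_le a b (r0 : {ffun 'I_N -> nat}) :
  (forall r, mle r0 r -> binom_value u a r <= binom_value u b r) -> a u <= b u.
Proof.
move=> le; have sh : shift_le (binom_expansion u a) (binom_expansion u b).
  exists (\sum_k r0 k)%N, 0%N => r rr.
  rewrite (meval_eq (v2 := fun k => (r k)%:R) (binom_expansion u b)) => [|k]; last by rewrite addn0.
  rewrite !meval_binom_expansion ler_int; apply: le; apply/mleP => k; rewrite ffunE.
  by apply: leq_trans (rr k); rewrite (bigD1 k) //= leq_addr.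
have supp c (m : 'X_{1..N}) : m \in msupp (binom_expansion u c) ->
    (wdeg (fun=> 1%N) m <= \sum_k u k)%N.
  move=> /msupp_binom_expansion[f [fu _] mf]; apply: leq_sum => k _.
  by rewrite mul1n; apply: leq_trans (mf k) (fu k).
have := @weighted_form_le _ (fun=> 1%N) (fun=> isT) _ _ _ sh (supp a) (supp b) (fun=> 1%N)
  (fun=> isT).
rewrite !weighted_form_binom_expansion !mevalZ !mevalX.
have -> : \prod_k (1%:R : rat) ^+ mnm_of u k = 1 by apply: big1 => k _; rewrite expr1n.
rewrite !mulr1.
rewrite ler_pM2r ?ler_int // invr_gt0 prodr_gt0 // => k _.
by rewrite ltr0n fact_gt0.
Qed.

End TopCoefficient.

(** * Dimension polynomials and change of generators *)

Section DimensionPolynomial.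
Variables (L : fieldType) (charL0 : [pchar L] =i pred0) (m n p : nat) (mm : 'I_p -> nat).
Hypothesis sum_mm : (\sum_(k < p) mm k)%N = m.
Variables (D : dsStructure m n L) (K : set L) (dsK : ds_subfield D K).

Local Notation X := (operator m n).
Local Notation kd := (@op_kind m n p mm).
Local Notation deg := (mdegree kd).
Local Notation u := (block_sizes n mm).

(** Each of the [2 ^ n] orthants contributes a count with top coefficient 1. *)
Lemma eventually_poly_normal_form : exists a, a u = (2 ^ n)%N%:Z /\
  eventually_poly u
    (fun r => (size [seq v <- @box_monomials m n p mm r | normal_form v])%:Z) a.
Proof.
have /choice[A AP] : forall eps : {ffun 'I_n -> bool}, exists a, a u = 1 /\
    eventually_poly u (fun r => (size [seq z <- mons (@orth_kind m n p mm) r |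
      mle (@orth_base m n p eps) z])%:Z) a.
  move=> eps; exact: (eventually_poly_above (card_orth_kind n sum_mm)).
exists (fun v => \sum_(eps <- index_enum {ffun 'I_n -> bool}) A eps v); split.
  rewrite (eq_bigr (fun=> 1)) => [|eps _]; last by case: (AP eps).
  by rewrite sumr_const card_ffun card_bool card_ord natz.
have [r0 H] := eventually_poly_sum (index_enum {ffun 'I_n -> bool}) (fun eps => (AP eps).2).
exists r0 => r /H <-; rewrite size_filter (eq_count (a2 := fun v => normal_form v && predT
  v)) => [|v].
  rewrite (count_orthants mm r predT) (big_morph Posz PoszD (erefl _)).
  by apply: eq_bigr => eps _; congr (size _)%:Z; apply: eq_filter => z; rewrite andbT.
by rewrite andbT.
Qed.

Lemma dimension_polynomial_exists (s : nat) (eta : 'I_s -> L) :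
  exists a, is_dim_poly D mm K eta (binom_expansion u a) /\ ((2 ^ n)%N%:Z %| a u)%Z.
Proof.
have /choice[A AP] : forall je : 'I_s * {ffun 'I_n -> bool}, exists a,
    [/\ a u = 1 \/ a u = 0, a u = 1 -> forall z, ~ orth_dependent mm D K eta je.1 je.2 z &
    eventually_poly u (fun r => (size [seq z <- mons (@orth_kind m n p mm) r |
      mle (@orth_base m n p je.2) z && ~~ `[< orth_dependent mm D K eta je.1 je.2 z >]])%:Z) a].
  move=> je; apply: (eventually_poly_avoid (card_orth_kind n sum_mm)).
  exact: orth_dependent_upclosed.
have AP3 j eps : eventually_poly u (fun r => (size [seq z <- mons (@orth_kind m n p mm) r |
      mle (@orth_base m n p eps) z && ~~ `[< orth_dependent mm D K eta j eps z >]])%:Z) (A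
        (j, eps)).
  by case: (AP (j, eps)).
pose a v := \sum_(j < s) \sum_(eps : {ffun 'I_n -> bool}) A (j, eps) v.
have [r0 H] : eventually_poly u (fun r => (size (basis_pairs mm D K eta r))%:Z) a.
  have [r0 H] := eventually_poly_sum (index_enum 'I_s) (fun j =>
     eventually_poly_sum (index_enum {ffun 'I_n -> bool}) (fun eps =>
       AP3 j eps)).
  exists r0 => r /H <-; rewrite (size_basis_pairs) (big_morph Posz PoszD (erefl _)).
  by apply: eq_bigr => j _; rewrite (big_morph Posz PoszD (erefl _)).
exists a; split.
  exists r0 => r rr; pose rf : {ffun 'I_p.+1 -> nat} := [ffun k => r k].
  have rE : rf = r :> (_ -> _) by apply/funext => k; rewrite ffunE.
  exists (size (basis_pairs mm D K eta r)); first exact: has_trdeg_box.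
  have r0f : mle r0 rf by apply/mleP => k; rewrite ffunE; apply: rr.
  by rewrite meval_binom_expansion -/rf -(H _ r0f) rE pmulrn.
(* The generators with coefficient 1 in the orthant [eps]; by [AP] they have no dependent word
   there, and the others contribute 0. *)
pose J eps : {set 'I_s} := [set j | A (j, eps) u == 1]%SET.
have auE : a u = \sum_(eps : {ffun 'I_n -> bool}) #|J eps|%:Z.
  rewrite /a exchange_big; apply: eq_bigr => eps _ /=.
  rewrite -sum1_card (big_morph Posz PoszD (erefl _)) [RHS]big_mkcond /=.
  apply: eq_bigr => j _; rewrite inE; case: (AP (j, eps)) => -[->|->] _ _ //.
(* For a largest [J eps0], translation into its orthant bounds [a u] below by [2 ^ n] times its
   size, and maximality gives the same bound above. *)
pose eps0 := [arg max_(eps > [ffun=> true] : {ffun 'I_n -> bool}) #|J eps|].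
have maxJ eps : (#|J eps| <= #|J eps0|)%N by rewrite /eps0; case: arg_maxnP => // e _; apply.
have [b [bu [r1 Hb]]] := eventually_poly_normal_form.
have ge_au : #|J eps0|%:Z * (2 ^ n)%N%:Z <= a u.
  rewrite -bu; apply: (@binom_value_top_le _ u (fun v => #|J eps0|%:Z * b v) a (madd r0 r1)).
  move=> r r01; have r0r : mle r0 r by apply: mle_trans r01; apply/mleP => k;
    rewrite ffunE leq_addr.
  have r1r : mle r1 r by apply: mle_trans r01; apply/mleP => k; rewrite ffunE leq_addl.
  have -> : binom_value u (fun v => #|J eps0|%:Z * b v) r = #|J eps0|%:Z * binom_value u b r.
    by rewrite /binom_value mulr_sumr; apply: eq_bigr => v _; rewrite mulrA.
  rewrite -Hb // -H // -PoszM lez_nat.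
  apply: (independent_orthant_le sum_mm dsK) => j; rewrite inE => /eqP au.
  by case: (AP (j, eps0)) => _ + _; apply.
have le_au : a u <= #|J eps0|%:Z * (2 ^ n)%N%:Z.
  rewrite auE; apply: (@le_trans _ _ (\sum_(eps : {ffun 'I_n -> bool}) #|J eps0|%:Z)).
    by apply: ler_sum => eps _; rewrite lez_nat.
  by rewrite sumr_const card_ffun card_bool card_ord -mulr_natr natz.
by apply/dvdzP; exists #|J eps0|%:Z; apply/le_anti; rewrite ge_au le_au.
Qed.

Lemma field_gen_box_op (s : nat) (eta : 'I_s -> L) (r r' : 'I_p.+1 -> nat) x z :
  (forall k, r k + (k == kd x) <= r' k)%N ->
  field_gen K (box_orbit D mm eta r) z ->
  field_gen K (box_orbit D mm eta r') (op_act D x z).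
Proof.
move=> rr' /(op_field_gen dsK (x := x)); apply: field_genS; rewrite !box_orbitE //.
move=> t [[i /in_boxP ir <-]|[t' [[v j] /in_boxP ir <-] <-]].
  exists i => //; apply/in_boxP => k; apply: leq_trans (ir k) (leq_trans _ (rr' k)).
  exact: leq_addr.
exists (mincr x v, j); last exact: orbit_pt_mincr.
by apply/in_boxP => k; rewrite /= mdegree_mincr (leq_trans _ (rr' k)) // leq_add2r ir.
Qed.

(** The elements reached by finite boxes form a subfield closed under all operators and containing
    [K] and the generators. *)
Lemma generators_in_box (s : nat) (zeta : 'I_s -> L) : ds_generates D K zeta ->
  forall y, exists c : nat, field_gen K (box_orbit D mm zeta (fun=> c)) y.
Proof.
move=> gen.
have boxS c d : (c <= d)%N ->
    field_gen K (box_orbit D mm zeta (fun=> c)) `<=` field_gen K (box_orbit D mm zeta (fun=> d)).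
  move=> cd; apply: field_genS => y [j [lam [lc ->]]]; exists j, lam; split=> // k.
  exact: leq_trans (lc k) cd.
pose F : set L := [set y | exists c : nat, field_gen K (box_orbit D mm zeta (fun=> c)) y].
have sFc c := field_gen_subfield K (box_orbit D mm zeta (fun=> c)).
have opF x y : F y -> F (op_act D x y).
  move=> [c Fy]; exists c.+1; apply: field_gen_box_op Fy => k.
  by rewrite -[c.+1]addn1 leq_add2l leq_b1.
suff FT : [set: L] `<=` F by move=> y; apply: FT.
rewrite -gen; apply: smallest_sub; first split.
- split.
  + by exists 0%N; apply: (subfield1 (sFc _)).
  + move=> x y [c Fx] [d Fy]; exists (maxn c d); apply: (subfieldB (sFc _)).
      exact: boxS (leq_maxl _ _) _ Fx.
    exact: boxS (leq_maxr _ _) _ Fy.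
  + move=> x y [c Fx] [d Fy]; exists (maxn c d); apply: (subfield_div (sFc _)).
      exact: boxS (leq_maxl _ _) _ Fx.
    exact: boxS (leq_maxr _ _) _ Fy.
- by move=> i x; apply: (opF (inl i)).
- by move=> j x; apply: (opF (inr (inl j))).
- by move=> j x; apply: (opF (inr (inr j))).
move=> y [Ky|[j _ <-]]; first by exists 0%N; apply: sub_field_genl.
exists 0%N; apply: sub_field_genr; rewrite box_orbitE //; exists ([ffun=> 0%N], j).
  by apply/in_boxP => k; rewrite /= ffunE big1 // => x _; rewrite ffunE.
exact: pp_act0.
Qed.

(** Each [eta j] lies in the field of some box of [zeta]; with a common size [C], the box [r] of
    [eta] goes into the field of the box [r + C] of [zeta]. *)
Lemma dim_poly_shift_le (s s' : nat) (eta : 'I_s -> L) (zeta : 'I_s' -> L)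
    (Phi Psi : {mpoly rat[p.+1]}) :
  ds_generates D K zeta -> is_dim_poly D mm K eta Phi -> is_dim_poly D mm K zeta Psi ->
  shift_le Phi Psi.
Proof.
move=> gen [r0 HPhi] [r1 HPsi].
have /choice[c cP] : forall j, exists c : nat, field_gen K (box_orbit D mm zeta (fun=> c)) (eta j).
  by move=> j; apply: generators_in_box.
pose C := (\sum_j c j)%N.
exists (\sum_k (r0 k + r1 k))%N, C => r rr.
have rr01 k : (r0 k + r1 k <= r k)%N by apply: leq_trans (rr k); rewrite (bigD1 k) //= leq_addr.
have [d td ->] := HPhi r (fun k => leq_trans (leq_addr _ _) (rr01 k)).
have [|d' td' ->] := HPsi (fun k => r k + C)%N.
  by move=> k; rewrite (leq_trans (leq_addl (r0 k) _)) // (leq_trans (rr01 k)) // leq_addr.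
rewrite ler_nat; case: (dsK) => sK _ _ _; apply: (has_trdeg_le sK td td').
apply: sub_acl_field_gen; rewrite box_orbitE // => _ [[v j] /in_boxP /= vr <-].
apply: sub_acl.
suff pt_in w : field_gen K (box_orbit D mm zeta (fun k => deg w k + C)%N) (orbit_pt D eta (w, j)).
  apply: field_genS (pt_in v) => y [l [lam [lc ->]]]; exists l, lam; split=> // k.
  by apply: leq_trans (lc k) _; rewrite leq_add2r.
pose o : {ffun X -> nat} := [ffun=> 0%N].
have ow : mle o w by apply/mleP => x; rewrite ffunE.
move: w ow; apply: mincr_ind => [|x w _ IH].
  rewrite /orbit_pt pp_act0; apply: field_genS (cP j) => y [l [lam [lc ->]]];
    exists l, lam; split=> // k.
  by apply: leq_trans (lc k) _; rewrite (leq_trans _ (leq_addl _ _)) // /C (bigD1 j) //= leq_addr.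
rewrite orbit_pt_mincr; apply: field_gen_box_op IH => k.
by rewrite mdegree_mincr addnAC.
Qed.

End DimensionPolynomial.

Lemma sum_block_sizes m n p (mm : 'I_p -> nat) : (\sum_(k < p) mm k)%N = m ->
  (\sum_k block_sizes n mm k)%N = (m + n)%N.
Proof.
move=> <-; rewrite big_ord_recr /= ffunE unlift_none; congr (_ + _)%N.
by apply: eq_bigr => i _; rewrite ffunE widen_ord_lift liftK.
Qed.

Theorem theorem3p1 (L : fieldType) (charL0 : [pchar L] =i pred0)
    (m n p : nat) (mm : 'I_p -> nat)
    (p_ge1 : (1 <= p)%N) (sum_mm : (\sum_(k < p) mm k)%N = m)
    (D : dsStructure m n L) (K : set L) (dsK : ds_subfield D K)
    (s : nat) (eta : 'I_s -> L) (eta_gen : ds_generates D K eta) :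
  let u := block_sizes n mm in
  exists (Phi : {mpoly rat[p.+1]}) (a : {ffun 'I_p.+1 -> nat} -> int),
    [/\ is_dim_poly D mm K eta Phi,
        [/\ forall k, (degree_in k Phi <= u k)%N,
            (msize Phi <= (m + n).+1)%N,
            Phi = binom_expansion u a &
            ((2 ^ n)%N%:Z %| a u)%Z] &
        forall (s' : nat) (zeta : 'I_s' -> L) (Psi : {mpoly rat[p.+1]})
            (b : {ffun 'I_p.+1 -> nat} -> int),
          ds_generates D K zeta ->
          is_dim_poly D mm K zeta Psi ->
          Psi = binom_expansion u b ->
          let Ea := expansion_support u a in
          let Eb := expansion_support u b in
          [/\ msize Phi = msize Psi,
              a u = b u,
              lex_maximal Ea = lex_maximal Eb,
              forall e, lex_maximal Ea e -> a e = b e &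
              forall mon : 'X_{1..p.+1}, (mdeg mon).+1 = msize Phi ->
                Phi@_mon = Psi@_mon]].

Proof.
move=> u; have [a [aPhi adiv]] := dimension_polynomial_exists charL0 sum_mm dsK eta.
exists (binom_expansion u a), a; split=> //.
- split=> //.
  + move=> k; apply/bigmax_leqP_seq => mon /msupp_binom_expansion[f [fu _] mf] _.
    exact: leq_trans (mf k) (fu k).
  + rewrite msizeE; apply/bigmax_leqP_seq => mon /msupp_binom_expansion[f [fu _] mf] _.
    rewrite ltnS mdegE -(sum_block_sizes n sum_mm); apply: leq_sum => k _.
    exact: leq_trans (mf k) (fu k).
(* Both [eta] and [zeta] generate [L], so the comparison holds in both directions. *)
- move=> s' zeta Psi b zeta_gen bPsi PsiE Ea Eb; rewrite PsiE in bPsi *.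
  apply: expansion_invariants.
    exact: (dim_poly_shift_le sum_mm dsK zeta_gen aPhi bPsi).
  exact: (dim_poly_shift_le sum_mm dsK eta_gen bPsi aPhi).
Qed.
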